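(* Let $\hbar\neq0$ and $t_2\neq0$ be constants, and consider the system of ODEs with respect to $t_1$ $$\hbar\frac{dq_i}{dt_1}=\frac{\partial H_1}{\partial p_i},\qquad \hbar\frac{dp_i}{dt_1}=-\frac{\partial H_1}{\partial q_i}\quad(i=1,2),\qquad H_1=p_1^2-(q_1^2+t_1)p_1-2p_2q_1q_2-q_2-\frac{t_2}{q_2}.$$ There exists a convergent Laurent series solution at $t_1=\alpha$ of the following form, with free parameters $(\alpha,\beta,\gamma,\delta)$ independent of $t_1$, where $\beta\neq0$ is assumed: $$\begin{aligned}q_1(t_1)={}&\frac{\hbar}{t_1-\alpha}-\frac{(\alpha-2\beta)(t_1-\alpha)}{3\hbar}+\frac{\gamma(t_1-\alpha)^2}{\hbar^2}+\frac{\delta(t_1-\alpha)^3}{\hbar^3}\\&-\frac{(3\alpha\gamma-10\beta\gamma+\alpha\hbar-2\beta\hbar)(t_1-\alpha)^4}{9\hbar^4}+O((t_1-\alpha)^5),\end{aligned}$$ $$\begin{aligned}q_2(t_1)={}&\frac{\beta\hbar^2}{(t_1-\alpha)^2}+\frac13(\alpha\beta-2\beta^2)-\frac{2\beta\gamma(t_1-\alpha)}{3\hbar}+\frac{(\alpha^2\beta-4\alpha\beta^2+4\beta^3-9\beta\delta)(t_1-\alpha)^2}{18\hbar^2}\\&+\frac{2(-2\alpha\beta\gamma+\alpha\beta\hbar-2\beta^2\hbar)(t_1-\alpha)^3}{45\hbar^3}+O((t_1-\alpha)^4),\end{aligned}$$ $$\begin{aligned}p_1(t_1)={}&\beta+\Bigl(\frac12+\frac{2\gamma}{\hbar}\Bigr)(t_1-\alpha)+\frac{(\alpha^2-4\alpha\beta+4\beta^2+45\delta)(t_1-\alpha)^2}{18\hbar^2}\\&-\frac{(4\alpha\gamma-12\beta\gamma+\alpha\hbar-2\beta\hbar)(t_1-\alpha)^3}{3\hbar^3}+O((t_1-\alpha)^4),\end{aligned}$$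 $$\begin{aligned}p_2(t_1)={}&-\frac{t_1-\alpha}{\hbar}-\frac{(4\gamma+\hbar)(t_1-\alpha)^2}{4\beta\hbar^2}+\frac{2(\alpha-2\beta)(t_1-\alpha)^3}{3\hbar^3}\\&+\frac{(4\alpha\gamma-20\beta\gamma+\alpha\hbar-2\beta\hbar)(t_1-\alpha)^4}{12\beta\hbar^4}+O((t_1-\alpha)^5).\end{aligned}$$ Namely, this system (the restriction to constant $t_2$ of the Garnier system of type $5/2+3/2$) passes the Painlevé test.
   Context: A differential equation (or system) is said to pass the (extended) Painlevé test if, assuming a Laurent series expansion of a solution at a generic reference point, all series coefficients are determined without contradiction, they contain as many free parameters as the order of the equation (here four: $\alpha,\beta,\gamma,\delta$, the position $\alpha$ of the pole being counted), and the Laurent series converges on a punctured neighborhood of the reference point. *)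

(* Defs.v *)
From Stdlib Require Import Reals ZArith List.
From Coquelicot Require Import Coquelicot.
Import ListNotations.

Open Scope C_scope.

(* The Laurent series sum_{n >= 0} lcoef n * s^(lord + n) in a local parameter
   s.  The coefficient lcoef 0 may vanish, so [lord] is only a lower bound for
   the order of the series; [leq] below is the equality of series. *)
Record laurent : Type := Laurent { lord : Z; lcoef : nat -> C }.

Definition coef (u : laurent) (k : Z) : C :=
  if (k <? lord u)%Z then 0 else lcoef u (Z.to_nat (k - lord u)).

Definition leq (u v : laurent) : Prop := forall k : Z, coef u k = coef v k.

Definition lconst (c : C) : laurent :=
  Laurent 0 (fun n => match n with O => c | _ => 0 end).

(* The independent variable t = alpha + s. *)
Definition ltime (alpha : C) : laurent :=
  Laurent 0 (fun n => match n with O => alpha | 1%nat => 1 | _ => 0 end).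

Definition lscal (c : C) (u : laurent) : laurent :=
  Laurent (lord u) (fun n => c * lcoef u n).

Definition ladd (u v : laurent) : laurent :=
  let m := Z.min (lord u) (lord v) in
  Laurent m (fun n => coef u (m + Z.of_nat n) + coef v (m + Z.of_nat n)).

Definition lsub (u v : laurent) : laurent := ladd u (lscal (-1) v).

Definition lmul (u v : laurent) : laurent :=
  Laurent (lord u + lord v)
    (fun n => sum_n (fun i => lcoef u i * lcoef v (n - i)%nat) n).

Definition lderiv (u : laurent) : laurent :=
  Laurent (lord u - 1)
    (fun n => RtoC (IZR (lord u + Z.of_nat n)) * lcoef u n).

Definition Cpowz (z : C) (k : Z) : C :=
  match k with
  | Z0 => 1
  | Zpos p => z ^ Pos.to_nat p
  | Zneg p => / z ^ Pos.to_nat p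
  end.

(* The series u in s = t - alpha converges at t, with sum l. *)
Definition is_laurent_sum (u : laurent) (alpha t l : C) : Prop :=
  exists sigma : C,
    is_pseries (K := C_AbsRing) (V := C_NormedModule)
      (lcoef u) (t - alpha) sigma /\
    l = Cpowz (t - alpha) (lord u) * sigma.

Definition punctured_disc (alpha : C) (r : R) (t : C) : Prop :=
  (0 < Cmod (t - alpha) < r)%R.

Definition converges_near (u : laurent) (alpha : C) : Prop :=
  exists r : R, (0 < r)%R /\
    forall t : C, punctured_disc alpha r t ->
      exists l : C, is_laurent_sum u alpha t l.

(* u = l_0 s^m + l_1 s^(m+1) + ... + l_j s^(m+j) + O(s^(m+j+1)). *)
Definition expands_as (u : laurent) (m : Z) (l : list C) : Prop :=
  lord u = m /\
  forall n : nat, (n < length l)%nat -> lcoef u n = nth n l 0.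

(* The Painleve test for an ODE system of total order [order] with unknowns
   indexed by I; [formal_solution alpha u] says that the family u of Laurent
   series in s = t - alpha solves the system formally.  For solutions with
   leading exponents m, the entry (i, k) of [free] declares that the
   coefficient of s^k in the unknown i is a free parameter.  The free
   coefficients take arbitrary values, except that a leading one is nonzero;
   at every reference point alpha they determine all the other coefficients,
   no contradiction arises, and the resulting series converge.  The position
   alpha of the pole is one more free parameter. *)
Definition passes_painleve_test (I : Type) (order : nat)
    (formal_solution : C -> (I -> laurent) -> Prop)
    (m : I -> Z) (free : list (I * Z)) : Prop :=
  (exists i : I, (m i < 0)%Z) /\
  NoDup free /\
  S (length free) = order /\
  forall (alpha : C) (value : I -> Z -> C),
    (forall i : I, In (i, m i) free -> value i (m i) <> 0) ->
    let expansion (u : I -> laurent) : Prop :=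
      (forall i : I, lord (u i) = m i /\ lcoef (u i) 0 <> 0) /\
      (forall (i : I) (k : Z), In (i, k) free -> coef (u i) k = value i k) /\
      formal_solution alpha u in
    exists u : I -> laurent,
      expansion u /\
      (forall u' : I -> laurent, expansion u' ->
         forall i : I, leq (u' i) (u i)) /\
      (forall i : I, converges_near (u i) alpha).

Inductive unknown : Type := Q1 | Q2 | P1 | P2.

Definition H1 (t2 t1 q1 q2 p1 p2 : C) : C :=
  p1 ^ 2 - (q1 ^ 2 + t1) * p1 - 2 * p2 * q1 * q2 - q2 - t2 / q2.

Definition is_Cderive (f : C -> C) (z l : C) : Prop :=
  is_derive (K := C_AbsRing) (V := C_NormedModule) f z l.

(* Hamilton's equations of H1 at t; q2 t <> 0 because H1 has a pole at
   q2 = 0. *)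
Definition garnier_solution_at (hbar t2 : C) (q1 q2 p1 p2 : C -> C) (t : C)
    : Prop :=
  q2 t <> 0 /\
  exists dq1 dq2 dp1 dp2 : C,
    (is_Cderive q1 t dq1 /\ is_Cderive q2 t dq2 /\
     is_Cderive p1 t dp1 /\ is_Cderive p2 t dp2) /\
    is_Cderive (fun x => H1 t2 t (q1 t) (q2 t) x (p2 t)) (p1 t) (hbar * dq1) /\
    is_Cderive (fun x => H1 t2 t (q1 t) (q2 t) (p1 t) x) (p2 t) (hbar * dq2) /\
    is_Cderive (fun x => H1 t2 t x (q2 t) (p1 t) (p2 t)) (q1 t)
      (- (hbar * dp1)) /\
    is_Cderive (fun x => H1 t2 t (q1 t) x (p1 t) (p2 t)) (q2 t)
      (- (hbar * dp2)).

(* The same equations for formal Laurent series, with the partial derivatives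
   of H1 written out:
     hbar q1' = 2 p1 - q1^2 - t1,      hbar q2' = - 2 q1 q2,
     hbar p1' = 2 q1 p1 + 2 p2 q2,     hbar p2' = 2 q1 p2 + 1 - t2 / q2^2.
   Laurent series form a field, and the last equation is multiplied by q2^2;
   for t2 <> 0 it forces q2 <> 0. *)
Definition garnier_formal_solution (hbar t2 alpha : C)
    (u : unknown -> laurent) : Prop :=
  let q1 := u Q1 in let q2 := u Q2 in let p1 := u P1 in let p2 := u P2 in
  leq (lscal hbar (lderiv q1))
      (lsub (lsub (lscal 2 p1) (lmul q1 q1)) (ltime alpha)) /\
  leq (lscal hbar (lderiv q2)) (lscal (-2) (lmul q1 q2)) /\
  leq (lscal hbar (lderiv p1))
      (ladd (lscal 2 (lmul q1 p1)) (lscal 2 (lmul p2 q2))) /\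
  leq (lmul (lmul q2 q2) (lscal hbar (lderiv p2)))
      (lsub (lmul (lmul q2 q2) (ladd (lscal 2 (lmul q1 p2)) (lconst 1)))
            (lconst t2)).

Definition garnier_exponent (i : unknown) : Z :=
  match i with Q1 => (-1)%Z | Q2 => (-2)%Z | P1 => 0%Z | P2 => 1%Z end.

(* The coefficients beta hbar^2, gamma / hbar^2 and delta / hbar^3. *)
Definition garnier_free : list (unknown * Z) :=
  [(Q2, (-2)%Z); (Q1, 2%Z); (Q1, 3%Z)].

(* Main.v *)
Require Import Defs.
From Stdlib Require Import Reals ZArith List Lra Lia ClassicalEpsilon.
From Coquelicot Require Import Coquelicot.
Import ListNotations.
Open Scope C_scope.

(* Write q1 = A/s, q2 = B/s^2, p1 = C, p2 = sD with s = t1 - alpha, and adjoin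
   E = 1/B^2, which satisfies hbar s E' = 4 (A - hbar) E.  The extended system
   is quadratic, and at order n it determines the coefficients of A, B, C, D, E
   after division by hbar times n + 1, n, n - 2, n - 1, n respectively.  The
   resonances n = 1 (for D) and n = 2 (for C) are compatible, and the two free
   coefficients can be traded for those of A at orders 3 and 4 (gamma and delta)
   through the equation of A, which contains C two orders lower; the leading
   coefficient of B gives beta.  Because of the factor n, an induction yields
   geometric bounds on the coefficients, so the series converge, may be
   multiplied and differentiated termwise, and solve the system. *)

(** * Cauchy products *)

(** The divisors are the coefficients of the top-order unknowns once [A(0) = hbar] is substituted;
    for instance [hbar (n - 1) A_n] on the left gains [2 hbar A_n] from the square of [A]. What
    blocks a uniform recursion is that the divisors of [D] and [C] vanish at n = 1 and n = 2. There
    the equation no longer sees [D_1], respectively [C_2], and only constrains known values. Instead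
    [D_1] is tied to [C_1] by the equation of [C] at order 1, while [C_1] and [C_2] reappear in
    [A_3] and [A_4]. Hence orders 0 to 2 are given by closed formulas and the recursion starts at
    order 3, where every divisor is nonzero. The series [E] removes the division in
    [t2 / q2^2 = t2 s^4 E]; as it solves a linear equation with coefficient [A], the same induction
    bounds it. Uniqueness works without [E], on the equation multiplied by [q2^2]. *)

Definition conv (f g : nat -> C) (n : nat) : C :=
  sum_n (fun i => f i * g (n - i)%nat) n.

(** As a series, (f - f(0)) / s; its counterpart [mulX] is multiplication by s. *)
Definition divX (f : nat -> C) (n : nat) : C := f (S n).

Definition mulX (f : nat -> C) (n : nat) : C :=
  match n with O => 0 | S k => f k end.

Definition ps1 (n : nat) : C := match n with O => 1 | _ => 0 end.

(** The Euler operator s d/ds, a derivation that leaves the indices unshifted. *)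
Definition theta (f : nat -> C) (n : nat) : C := RtoC (INR n) * f n.

Lemma conv_0 (f g : nat -> C) : conv f g 0 = f O * g O.
Proof. unfold conv. now rewrite sum_O. Qed.

Lemma conv_ext (f f' g g' : nat -> C) (n : nat) :
  (forall k, (k <= n)%nat -> f k = f' k) ->
  (forall k, (k <= n)%nat -> g k = g' k) -> conv f g n = conv f' g' n.
Proof.
intros Hf Hg; unfold conv; apply sum_n_ext_loc; intros k Hk.
now rewrite Hf, Hg by lia.
Qed.

Lemma conv_S_l (f g : nat -> C) (n : nat) :
  conv f g (S n) = f O * g (S n) + conv (divX f) g n.
Proof.
unfold conv, sum_n; rewrite sum_Sn_m by lia.
now rewrite <- sum_n_m_S.
Qed.

Lemma conv_S_r (f g : nat -> C) (n : nat) :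
  conv f g (S n) = conv f (divX g) n + f (S n) * g O.
Proof.
unfold conv; rewrite sum_Sn, Nat.sub_diag; apply f_equal2; [|easy].
apply sum_n_ext_loc; intros k Hk; unfold divX.
now replace (S n - k)%nat with (S (n - k)) by lia.
Qed.

(** Separates the two end terms, which hold the unknowns of top order, from a convolution of
    coefficients of lower positive index. *)
Lemma conv_SS (f g : nat -> C) (n : nat) :
  conv f g (S (S n)) =
  f O * g (S (S n)) + f (S (S n)) * g O + conv (divX f) (divX g) n.
Proof. rewrite conv_S_l, conv_S_r; unfold divX; ring. Qed.

Lemma conv_comm (f g : nat -> C) (n : nat) : conv f g n = conv g f n.
Proof.
revert f g; induction n as [|n IH]; intros f g.
- rewrite !conv_0; ring.
- rewrite conv_S_l, conv_S_r, IH; ring.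
Qed.

Lemma conv_lin_l (x y : C) (f f' g : nat -> C) (n : nat) :
  conv (fun k => x * f k + y * f' k) g n = x * conv f g n + y * conv f' g n.
Proof.
revert f f'; induction n as [|n IH]; intros f f'.
- rewrite !conv_0; ring.
- rewrite !conv_S_l.
  change (divX (fun k => x * f k + y * f' k))
    with (fun k => x * divX f k + y * divX f' k).
  rewrite IH; ring.
Qed.

Lemma conv_lin_r (x y : C) (f g g' : nat -> C) (n : nat) :
  conv f (fun k => x * g k + y * g' k) n = x * conv f g n + y * conv f g' n.
Proof. rewrite conv_comm, conv_lin_l, (conv_comm g), (conv_comm g'); ring. Qed.

Lemma conv_assoc (f g h : nat -> C) (n : nat) :
  conv (conv f g) h n = conv f (conv g h) n.
Proof.
revert f g h; induction n as [|n IH]; intros f g h.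
- rewrite !conv_0; ring.
- rewrite (conv_S_l (conv f g)), (conv_S_l f), (conv_S_l g), conv_0.
  rewrite (conv_ext (divX (conv f g))
    (fun k => f O * divX g k + 1 * conv (divX f) g k) h h).
  + rewrite conv_lin_l, IH; ring.
  + intros k _; unfold divX at 1; rewrite conv_S_l; unfold divX; ring.
  + easy.
Qed.

Lemma conv_mulX_r (f g : nat -> C) (n : nat) :
  conv f (mulX g) n = mulX (conv f g) n.
Proof.
destruct n as [|n].
- rewrite conv_0; simpl; ring.
- rewrite conv_S_r; simpl; rewrite Cmult_0_r, Cplus_0_r; reflexivity.
Qed.

Lemma theta_conv (f g : nat -> C) (n : nat) :
  theta (conv f g) n = conv (theta f) g n + conv f (theta g) n.
Proof.
unfold theta at 1, conv.
rewrite <- (sum_n_mult_l (K := C_Ring)).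
transitivity (sum_n (fun i => plus (theta f i * g (n - i)%nat)
                               (f i * theta g (n - i)%nat)) n).
- apply sum_n_ext_loc; intros k Hk; unfold theta.
  change (RtoC (INR n) * (f k * g (n - k)%nat) =
    RtoC (INR k) * f k * g (n - k)%nat + f k * (RtoC (INR (n - k)) * g (n - k)%nat)).
  rewrite minus_INR, RtoC_minus by easy; ring.
- exact (sum_n_plus (G := C_AbelianMonoid) (fun i => theta f i * g (n - i)%nat)
    (fun i => f i * theta g (n - i)%nat) n).
Qed.

Lemma mulX_ext (f g : nat -> C) : (forall n, f n = g n) ->
  forall n, mulX f n = mulX g n.
Proof. intros H [|n]; [easy|apply H]. Qed.

(** * Formal solutions and coefficient sequences *)

Lemma coef_below (u : laurent) (k : Z) : (k < lord u)%Z -> coef u k = 0.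
Proof. intros H; unfold coef; now apply Z.ltb_lt in H as ->. Qed.

Lemma coef_lord (u : laurent) (n : nat) :
  coef u (lord u + Z.of_nat n) = lcoef u n.
Proof.
unfold coef; rewrite (proj2 (Z.ltb_ge _ _)) by lia.
f_equal; lia.
Qed.

(** Only the differences of the two sides are compared, so that terms may change sides between the
    Laurent equation and the coefficient equation. *)
Lemma leq_iff (m : Z) (u v : laurent) (f g : nat -> C) :
  lord u = m -> lord v = m ->
  (forall n, coef u (m + Z.of_nat n) - coef v (m + Z.of_nat n) = f n - g n) ->
  (leq u v <-> forall n, f n = g n).
Proof.
intros Hu Hv E; split; intros H.
- intros n; apply Ceq_minus; rewrite <- E; apply -> Ceq_minus; apply H.
- intros k; destruct (Z.lt_ge_cases k m) as [Hk|Hk].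
  + now rewrite !coef_below by congruence.
  + replace k with (m + Z.of_nat (Z.to_nat (k - m)))%Z by lia.
    apply Ceq_minus; rewrite E; apply -> Ceq_minus; apply H.
Qed.

(** When an equation starts [p] orders below [u], the n-th coefficient of [u] in that equation is
    shifted by s^p; [mulX] supplies the leading zeros. *)
Lemma coef_mulX (u : laurent) (p n : nat) (k : Z) :
  (k + Z.of_nat p = lord u + Z.of_nat n)%Z ->
  coef u k = Nat.iter p mulX (lcoef u) n.
Proof.
revert n k; induction p as [|p IH]; intros n k H.
- replace k with (lord u + Z.of_nat n)%Z by lia; apply coef_lord.
- destruct n as [|n].
  + apply coef_below; lia.
  + apply IH; lia.
Qed.

Lemma coef_lscal (c : C) (u : laurent) (k : Z) :
  coef (lscal c u) k = c * coef u k.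
Proof. unfold coef; simpl; destruct (k <? lord u)%Z; [ring|easy]. Qed.

Lemma coef_ladd (u v : laurent) (k : Z) :
  coef (ladd u v) k = coef u k + coef v k.
Proof.
unfold coef at 1; simpl.
destruct (Z.ltb_spec k (Z.min (lord u) (lord v))) as [H|H].
- rewrite !coef_below by lia; ring.
- replace (Z.min (lord u) (lord v) +
    Z.of_nat (Z.to_nat (k - Z.min (lord u) (lord v))))%Z with k by lia.
  reflexivity.
Qed.

Lemma coef_lsub (u v : laurent) (k : Z) :
  coef (lsub u v) k = coef u k - coef v k.
Proof. unfold lsub; rewrite coef_ladd, coef_lscal; ring. Qed.

(* [a, b, c, d] hold the coefficients of [s q1, s^2 q2, p1, p2 / s]. *)
Definition garnier_equations (hbar t2 alpha : C) (a b c d : nat -> C) : Prop :=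
  (forall n, hbar * (RtoC (INR n) - 1) * a n =
     2 * mulX (mulX c) n - conv a a n - alpha * mulX (mulX ps1) n
     - mulX (mulX (mulX ps1)) n) /\
  (forall n, hbar * (RtoC (INR n) - 2) * b n = -2 * conv a b n) /\
  (forall n, hbar * RtoC (INR n) * c n = 2 * conv a c n + 2 * conv d b n) /\
  (forall n, conv (conv b b)
       (fun k => hbar * (RtoC (INR k) + 1) * d k - (2 * conv a d k + ps1 k)) n =
     - (t2 * mulX (mulX (mulX (mulX ps1))) n)).

Lemma IZR_plus_nat (m : Z) (n : nat) :
  RtoC (IZR (m + Z.of_nat n)) = RtoC (IZR m) + RtoC (INR n).
Proof. now rewrite plus_IZR, <- INR_IZR_INZ, RtoC_plus. Qed.

Lemma garnier_formal_solution_coef (hbar t2 alpha : C) (u : unknown -> laurent) :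
  (forall i, lord (u i) = garnier_exponent i) ->
  (garnier_formal_solution hbar t2 alpha u <->
   garnier_equations hbar t2 alpha (lcoef (u Q1)) (lcoef (u Q2))
     (lcoef (u P1)) (lcoef (u P2))).
Proof.
intros Hm.
generalize (Hm Q1) (Hm Q2) (Hm P1) (Hm P2).
unfold garnier_formal_solution, garnier_equations.
destruct (u Q1) as [m1 a], (u Q2) as [m2 b], (u P1) as [m3 c], (u P2) as [m4 d].
simpl lord; intros -> -> -> ->; simpl lcoef; unfold garnier_exponent.
assert (E : forall P P' Q Q' : Prop, (P <-> P') -> (Q <-> Q') ->
  (P /\ Q <-> P' /\ Q')) by (intros; tauto).
repeat apply E; clear E.
(* The orders -2, -3, -1, -4 at which the four equations start; each summand is then shifted by the
   gap between its own order and this one. *)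
- apply (leq_iff (-2)); [easy..|intros n].
  rewrite !coef_lsub, !coef_lscal.
  rewrite (coef_mulX (lderiv _) 0 n), (coef_mulX (Laurent 0 c) 2 n),
    (coef_mulX (lmul _ _) 0 n), (coef_mulX (ltime alpha) 2 n)
    by (cbn [lord lderiv lmul ltime]; lia).
  cbn [Nat.iter nat_rect lcoef lderiv lmul lord]. rewrite IZR_plus_nat.
  fold (conv a a n).
  replace (mulX (mulX (lcoef (ltime alpha))) n) with
    (alpha * mulX (mulX ps1) n + mulX (mulX (mulX ps1)) n)
    by (destruct n as [|[|[|[|n]]]]; simpl; ring).
  ring.
- apply (leq_iff (-3)); [easy..|intros n].
  rewrite !coef_lscal, (coef_mulX (lderiv _) 0 n), (coef_mulX (lmul _ _) 0 n)
    by (cbn [lord lderiv lmul]; lia).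
  cbn [Nat.iter nat_rect lcoef lderiv lmul lord]; rewrite IZR_plus_nat.
  fold (conv a b n); ring.
- apply (leq_iff (-1)); [easy..|intros n].
  rewrite coef_ladd, !coef_lscal, (coef_mulX (lderiv _) 0 n),
    (coef_mulX (lmul _ (Laurent 0 c)) 0 n),
    (coef_mulX (lmul _ (Laurent (-2) b)) 0 n)
    by (cbn [lord lderiv lmul]; lia).
  cbn [Nat.iter nat_rect lcoef lderiv lmul lord]; rewrite IZR_plus_nat.
  fold (conv a c n); fold (conv d b n); ring.
- apply (leq_iff (-4)); [easy..|intros n].
  rewrite coef_lsub, (coef_mulX (lmul _ (lscal _ _)) 0 n),
    (coef_mulX (lmul _ (ladd _ _)) 0 n), (coef_mulX (lconst t2) 4 n)
    by (cbn [lord lderiv lmul lscal ladd lconst]; lia).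
  cbn [Nat.iter nat_rect lcoef lmul].
  set (D := lscal hbar _); set (X := ladd _ _).
  assert (HX : forall k, lcoef X k = 2 * conv a d k + ps1 k).
  { intros k; rewrite <- coef_lord; unfold X.
    rewrite coef_ladd, coef_lscal, (coef_mulX (lmul _ _) 0 k),
      (coef_mulX (lconst 1) 0 k) by (cbn [lord lmul lscal ladd lconst]; lia).
    reflexivity. }
  assert (HD : forall k, lcoef D k = hbar * (RtoC (INR k) + 1) * d k).
  { intros k; cbn [D lscal lderiv lcoef lord]; rewrite IZR_plus_nat; ring. }
  change (conv (conv b b) (lcoef D) n -
    (conv (conv b b) (lcoef X) n - mulX (mulX (mulX (mulX (lcoef (lconst t2))))) n) =
    conv (conv b b)
      (fun k => hbar * (RtoC (INR k) + 1) * d k - (2 * conv a d k + ps1 k)) n -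
    - (t2 * mulX (mulX (mulX (mulX ps1))) n)).
  replace (mulX (mulX (mulX (mulX (lcoef (lconst t2))))) n) with
    (t2 * mulX (mulX (mulX (mulX ps1))) n)
    by (destruct n as [|[|[|[|[|n]]]]]; simpl; ring).
  rewrite (conv_ext (conv b b) (conv b b)
    (fun k => hbar * (RtoC (INR k) + 1) * d k - (2 * conv a d k + ps1 k))
    (fun k => 1 * lcoef D k + (-1) * lcoef X k)).
  + rewrite conv_lin_r; ring.
  + easy.
  + intros k _; rewrite HX, HD; ring.
Qed.

(** * Existence of the coefficients *)

(** [G n] tabulates the values of index below [n], with [x0] elsewhere; since [F n] reads only that
    range, the table may be replaced by the final sequence. *)
Lemma strong_recursion (X : Type) (x0 : X) (F : nat -> (nat -> X) -> X) :
  (forall n v w, (forall k, (k < n)%nat -> v k = w k) -> F n v = F n w) ->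
  exists v : nat -> X, forall n, v n = F n v.
Proof.
intros HF.
pose (G := nat_rect (fun _ => nat -> X) (fun _ => x0)
  (fun n g k => if (k =? n)%nat then F n g else g k)).
exists (fun n => F n (G n)); intros n; apply HF.
induction n as [|n IH]; intros k Hk; [lia|simpl].
destruct (Nat.eqb_spec k n) as [->|Hkn]; [easy|apply IH; lia].
Qed.

(* [e] holds the coefficients of [1 / (s^2 q2)^2]: adjoining this series makes
   all the nonlinear terms quadratic.  The equations are those of order [m + 3],
   solved for the unknowns of that order. *)
Definition recursion (hbar t2 : C) (a b c d e : nat -> C) : Prop :=
  forall m,
  hbar * (RtoC (INR m) + 4) * a (3 + m)%nat =
    2 * c (1 + m)%nat - conv (divX a) (divX a) (1 + m) - ps1 m /\
  hbar * (RtoC (INR m) + 3) * b (3 + m)%nat =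
    -2 * (a (3 + m)%nat * b O + conv (divX a) (divX b) (1 + m)) /\
  hbar * (RtoC (INR m) + 1) * c (3 + m)%nat =
    2 * (a (3 + m)%nat * c O + conv (divX a) (divX c) (1 + m)) +
    2 * (d (3 + m)%nat * b O + d O * b (3 + m)%nat
         + conv (divX d) (divX b) (1 + m)) /\
  hbar * (RtoC (INR m) + 2) * d (3 + m)%nat =
    2 * (a (3 + m)%nat * d O + conv (divX a) (divX d) (1 + m))
    - t2 * mulX e m /\
  hbar * (RtoC (INR m) + 3) * e (3 + m)%nat =
    4 * (a (3 + m)%nat * e O + conv (divX a) (divX e) (1 + m)).

(** The values of [c 1] and [c 2] are those for which the equation of [a] yields
    [a 3 = gamma / hbar^2] and [a 4 = delta / hbar^3]; then [d 1] is forced by [c 1]. *)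
Definition initial (hbar alpha beta gamma delta : C) (a b c d e : nat -> C)
    : Prop :=
  (a 0%nat = hbar /\ b 0%nat = beta * hbar ^ 2 /\ c 0%nat = beta /\
   d 0%nat = - (1 / hbar) /\ e 0%nat = 1 / (beta * hbar ^ 2) ^ 2) /\
  (a 1%nat = 0 /\ b 1%nat = 0 /\ c 1%nat = 1 / 2 + 2 * gamma / hbar /\
   d 1%nat = - ((4 * gamma + hbar) / (4 * beta * hbar ^ 2)) /\ e 1%nat = 0) /\
  (a 2%nat = - ((alpha - 2 * beta) / (3 * hbar)) /\
   b 2%nat = 1 / 3 * (alpha * beta - 2 * beta ^ 2) /\
   c 2%nat = (alpha ^ 2 - 4 * alpha * beta + 4 * beta ^ 2 + 45 * delta)
     / (18 * hbar ^ 2) /\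
   d 2%nat = 2 * (alpha - 2 * beta) / (3 * hbar ^ 3) /\
   e 2%nat = - (2 * (alpha - 2 * beta) / (3 * hbar ^ 2))
     * (1 / (beta * hbar ^ 2) ^ 2)).

Lemma INR_plus_neq_0 (m : nat) (x : R) : (0 < x)%R -> RtoC (INR m) + RtoC x <> 0.
Proof.
intros Hx H; rewrite <- RtoC_plus in H; apply RtoC_inj in H.
generalize (pos_INR m); lra.
Qed.

Lemma conv_divX_ext (f f' g g' : nat -> C) (n : nat) :
  (forall k, (k < 2 + n)%nat -> f k = f' k) ->
  (forall k, (k < 2 + n)%nat -> g k = g' k) ->
  conv (divX f) (divX g) n = conv (divX f') (divX g') n.
Proof.
intros Hf Hg; apply conv_ext; intros k Hk; unfold divX;
  [apply Hf|apply Hg]; lia.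
Qed.

Lemma coefficients_exist (hbar t2 alpha beta gamma delta : C) :
  hbar <> 0 ->
  exists a b c d e : nat -> C,
    initial hbar alpha beta gamma delta a b c d e /\
    recursion hbar t2 a b c d e.
Proof.
intros Hh.
pose (pa := fun x : C * C * C * C * C => fst (fst (fst (fst x)))).
pose (pb := fun x : C * C * C * C * C => snd (fst (fst (fst x)))).
pose (pc := fun x : C * C * C * C * C => snd (fst (fst x))).
pose (pd := fun x : C * C * C * C * C => snd (fst x)).
pose (pe := fun x : C * C * C * C * C => snd x).
pose (F := fun n (v : nat -> C * C * C * C * C) =>
  let a k := pa (v k) in let b k := pb (v k) in let c k := pc (v k) in
  let d k := pd (v k) in let e k := pe (v k) in
  match n with
  | 0%nat => (hbar, beta * hbar ^ 2, beta, - (1 / hbar),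
              1 / (beta * hbar ^ 2) ^ 2)
  | 1%nat => (RtoC 0, RtoC 0, 1 / 2 + 2 * gamma / hbar,
              - ((4 * gamma + hbar) / (4 * beta * hbar ^ 2)), RtoC 0)
  | 2%nat => (- ((alpha - 2 * beta) / (3 * hbar)),
              1 / 3 * (alpha * beta - 2 * beta ^ 2),
              (alpha ^ 2 - 4 * alpha * beta + 4 * beta ^ 2 + 45 * delta)
                / (18 * hbar ^ 2),
              2 * (alpha - 2 * beta) / (3 * hbar ^ 3),
              - (2 * (alpha - 2 * beta) / (3 * hbar ^ 2))
                * (1 / (beta * hbar ^ 2) ^ 2))
  | S (S (S m)) =>
      (* The system is triangular at each order: [a] needs [c] only two orders lower, then come [b],
         [d], [e], and [c] is last because it uses the new [a], [b] and [d]. *)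
      let x := (2 * c (1 + m)%nat - conv (divX a) (divX a) (1 + m) - ps1 m)
               / (hbar * (RtoC (INR m) + 4)) in
      let y := -2 * (x * b O + conv (divX a) (divX b) (1 + m))
               / (hbar * (RtoC (INR m) + 3)) in
      let z := (2 * (x * d O + conv (divX a) (divX d) (1 + m)) - t2 * mulX e m)
               / (hbar * (RtoC (INR m) + 2)) in
      let w := 4 * (x * e O + conv (divX a) (divX e) (1 + m))
               / (hbar * (RtoC (INR m) + 3)) in
      (x, y,
       (2 * (x * c O + conv (divX a) (divX c) (1 + m)) +
        2 * (z * b O + d O * y + conv (divX d) (divX b) (1 + m)))
       / (hbar * (RtoC (INR m) + 1)), z, w)
  end).
destruct (strong_recursion _ (RtoC 0, RtoC 0, RtoC 0, RtoC 0, RtoC 0) F)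
  as [v Hv].
{ intros [|[|[|m]]] v w H; [easy..|].
  assert (E : forall k, (k < 2 + (1 + m))%nat -> v k = w k)
    by (intros k Hk; apply H; lia).
  unfold F.
  assert (Ec : forall p q : C * C * C * C * C -> C,
    conv (divX (fun k => p (v k))) (divX (fun k => q (v k))) (1 + m) =
    conv (divX (fun k => p (w k))) (divX (fun k => q (w k))) (1 + m))
    by (intros p q; apply conv_divX_ext; intros k Hk; now rewrite E).
  rewrite !Ec, (E (1 + m)%nat), (E O) by lia.
  replace (mulX (fun k => pe (v k)) m) with (mulX (fun k => pe (w k)) m)
    by (destruct m; [easy|simpl; rewrite E; [easy|lia]]).
  reflexivity. }
exists (fun k => pa (v k)), (fun k => pb (v k)), (fun k => pc (v k)),
  (fun k => pd (v k)), (fun k => pe (v k)); split.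
- unfold initial.
  rewrite (Hv 0%nat), (Hv 1%nat), (Hv 2%nat); repeat split.
- intros m.
  rewrite (Hv (3 + m)%nat).
  change (F (3 + m)%nat v) with (F (S (S (S m))) v).
  cbv beta iota delta [F].
  cbv zeta; unfold pa, pb, pc, pd, pe; cbn [fst snd].
  generalize (INR_plus_neq_0 m 1) (INR_plus_neq_0 m 2) (INR_plus_neq_0 m 3)
    (INR_plus_neq_0 m 4).
  intros H1 H2 H3 H4.
  repeat split; field; repeat split; (exact Hh || (apply H1; lra) ||
    (apply H2; lra) || (apply H3; lra) || (apply H4; lra)).
Qed.

Lemma RtoC_INR_S (n : nat) : RtoC (INR (S n)) = RtoC (INR n) + 1.
Proof. now rewrite S_INR, RtoC_plus. Qed.

Lemma conv_1 (f g : nat -> C) : conv f g 1 = f O * g 1%nat + f 1%nat * g O.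
Proof. now rewrite conv_S_l, conv_0. Qed.

Lemma conv_2 (f g : nat -> C) :
  conv f g 2 = f O * g 2%nat + f 1%nat * g 1%nat + f 2%nat * g O.
Proof. rewrite conv_SS, conv_0; unfold divX; ring. Qed.

Definition quadratic_system (hbar t2 alpha : C) (a b c d e : nat -> C) : Prop :=
  forall n,
  hbar * (RtoC (INR n) - 1) * a n =
     2 * mulX (mulX c) n - conv a a n - alpha * mulX (mulX ps1) n
     - mulX (mulX (mulX ps1)) n /\
  hbar * (RtoC (INR n) - 2) * b n = -2 * conv a b n /\
  hbar * RtoC (INR n) * c n = 2 * conv a c n + 2 * conv d b n /\
  hbar * (RtoC (INR n) + 1) * d n =
     2 * conv a d n + ps1 n - t2 * mulX (mulX (mulX (mulX e))) n /\
  hbar * RtoC (INR n) * e n = 4 * conv a e n - 4 * hbar * e n.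

(** Orders 0 to 2 are checked on the explicit values, which is where the resonances prove
    compatible. From order 3 on, moving the end terms [a 0 * _] with [a 0 = hbar] across the
    equations turns the recursion back into the system. *)
Lemma quadratic_equations (hbar t2 alpha beta gamma delta : C)
    (a b c d e : nat -> C) :
  hbar <> 0 -> beta <> 0 ->
  initial hbar alpha beta gamma delta a b c d e ->
  recursion hbar t2 a b c d e -> quadratic_system hbar t2 alpha a b c d e.
Proof.
intros Hh Hb Hi Hr n.
destruct Hi as [[a0 [b0 [c0 [d0 e0]]]] [[a1 [b1 [c1 [d1 e1]]]]
  [a2 [b2 [c2 [d2 e2]]]]]].
destruct n as [|[|[|m]]].
- rewrite !conv_0, a0, b0, c0, d0, e0; simpl.
  repeat split; field; auto.
- rewrite !conv_1, a0, b0, c0, d0, e0, a1, b1, c1, d1, e1; simpl.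
  repeat split; field; auto.
- rewrite !conv_2, a0, b0, c0, d0, e0, a1, b1, c1, d1, e1, a2, b2, c2, d2, e2.
  rewrite !RtoC_INR_S; simpl; rewrite c0.
  repeat split; field; auto.
- destruct (Hr m) as [Ea [Eb [Ec [Ed Ee]]]].
  rewrite !conv_SS, !RtoC_INR_S.
  change (mulX (mulX c) (S (S (S m)))) with (c (S m)).
  change (mulX (mulX ps1) (S (S (S m)))) with (RtoC 0).
  change (mulX (mulX (mulX ps1)) (S (S (S m)))) with (ps1 m).
  change (mulX (mulX (mulX (mulX e))) (S (S (S m)))) with (mulX e m).
  change (ps1 (S (S (S m)))) with (RtoC 0).
  cbn [Nat.add] in *; rewrite a0.
  repeat split.
  + transitivity (hbar * (RtoC (INR m) + 4) * a (S (S (S m)))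
      - 2 * hbar * a (S (S (S m)))); [ring|rewrite Ea; ring].
  + transitivity (hbar * (RtoC (INR m) + 3) * b (S (S (S m)))
      - 2 * hbar * b (S (S (S m)))); [ring|rewrite Eb; ring].
  + transitivity (hbar * (RtoC (INR m) + 1) * c (S (S (S m)))
      + 2 * hbar * c (S (S (S m)))); [ring|rewrite Ec; ring].
  + transitivity (hbar * (RtoC (INR m) + 2) * d (S (S (S m)))
      + 2 * hbar * d (S (S (S m)))); [ring|rewrite Ed; ring].
  + transitivity (hbar * (RtoC (INR m) + 3) * e (S (S (S m))));
      [ring|rewrite Ee; ring].
Qed.

(* [theta (b * b * e) = 0], by the Leibniz rule for [theta = s d/ds]. *)
Lemma inverse_square (hbar : C) (a b e : nat -> C) :
  hbar <> 0 -> b O ^ 2 * e O = 1 ->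
  (forall n, hbar * (RtoC (INR n) - 2) * b n = -2 * conv a b n) ->
  (forall n, hbar * RtoC (INR n) * e n = 4 * conv a e n - 4 * hbar * e n) ->
  forall n, conv (conv b b) e n = ps1 n.
Proof.
intros Hh H0 Eb Ee.
assert (Tb : forall n, theta b n = (-2 / hbar) * conv a b n + 2 * b n).
{ intros n; unfold theta.
  transitivity ((hbar * (RtoC (INR n) - 2) * b n) / hbar + 2 * b n);
    [now field|rewrite Eb; now field]. }
assert (Te : forall n, theta e n = (4 / hbar) * conv a e n + (-4) * e n).
{ intros n; unfold theta.
  transitivity ((hbar * RtoC (INR n) * e n) / hbar);
    [now field|rewrite Ee; now field]. }
(* Logarithmic derivatives: [b * b] contributes [4 - 4 a / hbar] and [e] contributes
   [4 a / hbar - 4], which cancel in the product. *)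
assert (Tbb : forall n, theta (conv b b) n =
  (-4 / hbar) * conv a (conv b b) n + 4 * conv b b n).
{ intros n; rewrite theta_conv, (conv_comm b (theta b)).
  rewrite (conv_ext (theta b) _ b b n (fun k _ => Tb k) (fun _ _ => eq_refl)).
  rewrite conv_lin_l, conv_assoc; now field. }
assert (T : forall n, theta (conv (conv b b) e) n = 0).
{ intros n; rewrite theta_conv.
  rewrite (conv_ext (theta (conv b b)) _ e e n (fun k _ => Tbb k)
    (fun _ _ => eq_refl)).
  rewrite (conv_ext (conv b b) (conv b b) (theta e) _ n (fun _ _ => eq_refl)
    (fun k _ => Te k)).
  rewrite conv_lin_l, conv_lin_r, <- (conv_assoc (conv b b) a e).
  rewrite (conv_ext (conv (conv b b) a) (conv a (conv b b)) e e n
    (fun k _ => conv_comm _ _ k) (fun _ _ => eq_refl)).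
  now field. }
intros [|n].
- rewrite !conv_0; simpl; rewrite <- H0; ring.
(* The kernel of [theta] consists of the constants, since the factor n is invertible for n > 0. *)
- generalize (T (S n)); unfold theta; intros Hn.
  destruct (Ceq_dec (conv (conv b b) e (S n)) 0) as [E|E]; [exact E|].
  exfalso; revert Hn; apply Cmult_neq_0; [|exact E].
  intros Hn; apply RtoC_inj in Hn; revert Hn; apply not_0_INR; lia.
Qed.

(** The bracket in the last equation equals [- t2 s^4 e], and convolving it with [b * b] leaves
    [- t2 s^4]. *)
Lemma garnier_equations_of_quadratic (hbar t2 alpha : C) (a b c d e : nat -> C) :
  (forall n, conv (conv b b) e n = ps1 n) ->
  quadratic_system hbar t2 alpha a b c d e ->
  garnier_equations hbar t2 alpha a b c d.
Proof.
intros Hbe H; repeat split; intros n; [apply H..|].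
rewrite (conv_ext (conv b b) (conv b b) _
  (fun k => (- t2) * mulX (mulX (mulX (mulX e))) k + 0 * ps1 k)).
- rewrite conv_lin_r, conv_mulX_r.
  rewrite (mulX_ext _ (mulX (mulX (mulX ps1)))); [ring|].
  intros k; rewrite conv_mulX_r; apply mulX_ext.
  intros k'; rewrite conv_mulX_r; apply mulX_ext.
  intros k''; rewrite conv_mulX_r; now apply mulX_ext.
- easy.
- intros k _; destruct (H k) as [_ [_ [_ [-> _]]]]; ring.
Qed.

(** * Geometric bounds *)

Lemma Cmod_plus_le (u v : C) (x y : R) :
  (Cmod u <= x)%R -> (Cmod v <= y)%R -> (Cmod (u + v) <= x + y)%R.
Proof. intros Hu Hv; generalize (Cmod_triangle u v); lra. Qed.

Lemma Cmod_minus_le (u v : C) (x y : R) :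
  (Cmod u <= x)%R -> (Cmod v <= y)%R -> (Cmod (u - v) <= x + y)%R.
Proof.
intros Hu Hv; apply Cmod_plus_le; [easy|now rewrite Cmod_opp].
Qed.

Lemma Cmod_mult_le (u v : C) (x y : R) :
  (Cmod u <= x)%R -> (Cmod v <= y)%R -> (Cmod (u * v) <= x * y)%R.
Proof.
intros Hu Hv; rewrite Cmod_mult; apply Rmult_le_compat; auto using Cmod_ge_0.
Qed.

Lemma Cmod_sum_n_le (u : nat -> C) (x : R) (n : nat) :
  (forall k, (k <= n)%nat -> (Cmod (u k) <= x)%R) ->
  (Cmod (sum_n u n) <= (INR n + 1) * x)%R.
Proof.
induction n as [|n IH]; intros H.
- rewrite sum_O; simpl; generalize (H O (le_n _)); lra.
- rewrite sum_Sn, S_INR.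
  replace ((INR n + 1 + 1) * x)%R with ((INR n + 1) * x + x)%R by ring.
  apply Cmod_plus_le; [apply IH; intros k Hk|]; apply H; lia.
Qed.

Lemma Cmod_conv_le (f g : nat -> C) (M N K : R) (n : nat) :
  (forall k, (k <= n)%nat -> (Cmod (f k) <= M * K ^ k)%R) ->
  (forall k, (k <= n)%nat -> (Cmod (g k) <= N * K ^ k)%R) ->
  (Cmod (conv f g n) <= (INR n + 1) * (M * N * K ^ n))%R.
Proof.
intros Hf Hg; apply Cmod_sum_n_le; intros k Hk.
replace (M * N * K ^ n)%R with ((M * K ^ k) * (N * K ^ (n - k)))%R.
- apply Cmod_mult_le; [apply Hf|apply Hg]; lia.
- replace (K ^ n)%R with (K ^ k * K ^ (n - k))%R; [ring|].
  rewrite <- pow_add; f_equal; lia.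
Qed.

Definition geometric (M K : R) (f : nat -> C) : Prop :=
  forall n, (Cmod (f n) <= M * K ^ n)%R.

Lemma finite_bound (u : nat -> R) (n : nat) (x : R) : (0 < x)%R ->
  exists K, (1 <= K)%R /\ forall k, (k <= n)%nat -> (u k <= x * K)%R.
Proof.
intros Hx; induction n as [|n [K [HK H]]].
- exists (Rmax 1 (u O / x)); split; [apply Rmax_l|].
  intros k Hk; replace k with O by lia.
  apply Rle_trans with (x * (u O / x))%R; [right; field; lra|].
  apply Rmult_le_compat_l; [lra|apply Rmax_r].
- exists (Rmax K (u (S n) / x)); split.
  { apply Rle_trans with (1 := HK), Rmax_l. }
  intros k Hk; destruct (Nat.eq_dec k (S n)) as [->|E].
  + apply Rle_trans with (x * (u (S n) / x))%R; [right; field; lra|].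
    apply Rmult_le_compat_l; [lra|apply Rmax_r].
  + apply Rle_trans with (x * K)%R; [apply H; lia|].
    apply Rmult_le_compat_l; [lra|apply Rmax_l].
Qed.

(** The right side is split evenly: [T * y] takes at most half of [j * h * y], and 12 times h/24
    gives the other half. This fixes the constant 24. *)
Lemma absorb (h T y x j : R) : (0 < h)%R -> (0 < j)%R -> (2 * T <= j * h)%R ->
  (0 <= y)%R -> (j * h * x <= T * y + 12 * (j * (h / 24 * y)))%R -> (x <= y)%R.
Proof.
intros Hh Hj HT Hy H.
assert (0 < j * h)%R by now apply Rmult_lt_0_compat.
apply Rmult_le_reg_l with (j * h)%R; [easy|].
assert (T * y <= j * h / 2 * y)%R by (apply Rmult_le_compat_r; lra).
lra.
Qed.

(* The quadratic terms sum over [0 < i < n], so if the coefficients of positive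
   index below [n] are at most [eps * K ^ k], these terms are at most
   [n * eps ^ 2 * K ^ n]; the factor [n] is compensated by the one coming from
   the derivative, and the linear terms are absorbed for large [n]. *)
Lemma recursion_geometric (hbar t2 : C) (a b c d e : nat -> C) :
  hbar <> 0 -> recursion hbar t2 a b c d e ->
  exists M K, (0 < M)%R /\ (1 <= K)%R /\ geometric M K a /\ geometric M K b /\
    geometric M K c /\ geometric M K d /\ geometric M K e.
Proof.
intros Hh Hr.
set (h := Cmod hbar); assert (Hh0 : (0 < h)%R) by now apply Cmod_gt_0.
(* Dominates the linear terms of all five equations; 6 is the case of [c], whose coefficients 2 are
   multiplied by the loss 3 from comparing m + 3 with m + 1. *)
set (T := (6 * (Cmod (b O) + Cmod (c O) + Cmod (d O) + Cmod (e O)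
                + Cmod t2 + 1))%R).
set (m0 k := (Cmod (a k) + Cmod (b k) + Cmod (c k) + Cmod (d k) + Cmod (e k))%R).
destruct (INR_unbounded (2 * T / h)) as [N0 HN0].
(* Past order 4 + N0 the derivative factor beats [T]; the 4 also ensures m > 1 there, so that
   [ps1 m] vanishes and [mulX e m] has positive index. *)
destruct (finite_bound m0 (4 + N0) (h / 24)) as [K [HK Hinit]]; [lra|].
assert (Hpos : forall z, (0 <= Cmod z)%R) by apply Cmod_ge_0.
assert (HKp : forall k, (1 <= K ^ k)%R) by (intros k; now apply pow_R1_Rle).
assert (B : forall n, (1 <= n)%nat ->
  (Cmod (a n) <= h / 24 * K ^ n /\ Cmod (b n) <= h / 24 * K ^ n /\
   Cmod (c n) <= h / 24 * K ^ n /\ Cmod (d n) <= h / 24 * K ^ n /\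
   Cmod (e n) <= h / 24 * K ^ n)%R).
{ intros n; induction n as [n IH] using lt_wf_ind; intros Hn.
  destruct (le_lt_dec n (4 + N0)) as [Hn0|Hn0].
  { assert (m0 n <= h / 24 * K ^ n)%R.
    { apply Rle_trans with (1 := Hinit n Hn0), Rmult_le_compat_l; [lra|].
      rewrite <- (pow_1 K) at 1; now apply Rle_pow. }
    unfold m0 in H.
    generalize (Hpos (a n)) (Hpos (b n)) (Hpos (c n)) (Hpos (d n)) (Hpos (e n)).
    lra. }
  destruct n as [|[|[|m]]]; try lia.
  set (Y := (h / 24 * K ^ S (S (S m)))%R).
  assert (HY : (0 <= Y)%R) by
    (apply Rmult_le_pos; [lra|generalize (HKp (S (S (S m)))); lra]).
  set (j := (INR m + 3)%R).
  assert (Hm : (0 <= INR m)%R) by apply pos_INR.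
  assert (Hj : (0 < j)%R) by (unfold j; lra).
  assert (HT : (2 * T <= j * h)%R).
  { assert (INR N0 <= INR m)%R by (apply le_INR; lia).
    apply Rle_trans with (2 * T / h * h)%R; [right; field; lra|].
    apply Rmult_le_compat_r; unfold j; lra. }
  assert (Hlow : forall k, (k < S (S (S m)))%nat -> (h / 24 * K ^ k <= Y)%R).
  { intros k Hk; apply Rmult_le_compat_l; [lra|apply Rle_pow; [easy|lia]]. }
  assert (Hconv : forall f g : nat -> C,
    (forall k, (1 <= k < S (S (S m)))%nat -> (Cmod (f k) <= h / 24 * K ^ k)%R) ->
    (forall k, (1 <= k < S (S (S m)))%nat -> (Cmod (g k) <= h / 24 * K ^ k)%R) ->
    (Cmod (conv (divX f) (divX g) (1 + m)) <= j * (h / 24 * Y))%R).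
  { intros f g Hf Hg.
    apply Rle_trans with ((INR (1 + m) + 1) *
      ((h / 24 * K) * (h / 24 * K) * K ^ (1 + m)))%R.
    - apply Cmod_conv_le; intros k Hk; unfold divX;
        (apply Rle_trans with (h / 24 * K ^ S k)%R; [|simpl; right; ring]);
        [apply Hf|apply Hg]; lia.
    - replace (h / 24 * K * (h / 24 * K) * K ^ (1 + m))%R with (h / 24 * Y)%R
        by (unfold Y; simpl; ring).
      apply Rmult_le_compat_r; [apply Rmult_le_pos; lra|].
      change (1 + m)%nat with (S m); rewrite S_INR; unfold j; lra. }
  assert (Ba : forall k, (1 <= k < S (S (S m)))%nat ->
    (Cmod (a k) <= h / 24 * K ^ k)%R) by (intros k Hk; apply IH; lia).
  assert (Bb : forall k, (1 <= k < S (S (S m)))%nat ->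
    (Cmod (b k) <= h / 24 * K ^ k)%R) by (intros k Hk; apply IH; lia).
  assert (Bc : forall k, (1 <= k < S (S (S m)))%nat ->
    (Cmod (c k) <= h / 24 * K ^ k)%R) by (intros k Hk; apply IH; lia).
  assert (Bd : forall k, (1 <= k < S (S (S m)))%nat ->
    (Cmod (d k) <= h / 24 * K ^ k)%R) by (intros k Hk; apply IH; lia).
  assert (Be : forall k, (1 <= k < S (S (S m)))%nat ->
    (Cmod (e k) <= h / 24 * K ^ k)%R) by (intros k Hk; apply IH; lia).
  assert (Hc1 : (Cmod (c (1 + m)%nat) <= Y)%R).
  { apply Rle_trans with (1 := Bc (1 + m)%nat ltac:(lia)), Hlow; lia. }
  assert (He1 : (Cmod (mulX e m) <= Y)%R).
  { destruct m as [|[|m]]; try lia.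
    apply Rle_trans with (1 := Be (S m) ltac:(lia)), Hlow; lia. }
  assert (Hps1 : (Cmod (ps1 m) <= 0)%R)
    by (destruct m; [lia|simpl; rewrite Cmod_0; lra]).
  assert (Hcst : forall x, (0 <= x)%R -> (Cmod (RtoC x) <= x)%R)
    by (intros x Hx; rewrite Cmod_R, Rabs_pos_eq; lra).
  assert (Hm2 : (Cmod (-2) <= 2)%R)
    by (rewrite Cmod_R, Rabs_left; lra).
  assert (HL : forall (x : R) (z : C), (0 <= x)%R ->
    Cmod (hbar * (RtoC (INR m) + RtoC x) * z) =
    (INR m * (h * Cmod z) + x * (h * Cmod z))%R).
  { intros x z Hx; rewrite !Cmod_mult, <- RtoC_plus, Cmod_R, Rabs_pos_eq by lra.
    fold h; ring. }
  destruct (Hr m) as [Ea [Eb [Ec [Ed Ee]]]].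
  cbn [Nat.add] in *.
  apply (f_equal Cmod) in Ea, Eb, Ec, Ed, Ee.
  rewrite HL in Ea, Eb, Ec, Ed, Ee by lra.
  (* The left sides carry m + x with x from 1 to 4, while [absorb] needs j = m + 3. The worst case
     is [c], with j at most 3 (m + 1): its quadratic coefficients 2 + 2 become 12. *)
  assert (Hjz : forall z : C,
    (j * h * Cmod z = INR m * (h * Cmod z) + 3 * (h * Cmod z))%R)
    by (intros z; unfold j; ring).
  assert (Hhz : forall z, (0 <= h * Cmod z)%R) by
    (intros z; apply Rmult_le_pos; [lra|easy]).
  assert (Hmz : forall z, (0 <= INR m * (h * Cmod z))%R) by
    (intros z; apply Rmult_le_pos; [lra|easy]).
  assert (HTY : forall x, (0 <= x)%R -> (0 <= x * Y)%R)
    by (intros x Hx; now apply Rmult_le_pos).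
  set (V := (j * (h / 24 * Y))%R) in *.
  assert (HV : (0 <= V)%R) by
    (apply Rmult_le_pos; [lra|apply Rmult_le_pos; lra]).
  assert (HTe : (T * Y = 6 * (Cmod (b O) * Y + Cmod (c O) * Y + Cmod (d O) * Y
     + Cmod (e O) * Y + Cmod t2 * Y + Y))%R) by (unfold T; ring).
  generalize (HTY _ (Hpos (b O))) (HTY _ (Hpos (c O))) (HTY _ (Hpos (d O)))
    (HTY _ (Hpos (e O))) (HTY _ (Hpos t2)).
  intros Y1 Y2 Y3 Y4 Y5.
  assert (Ra : (Cmod (a (S (S (S m)))) <= Y)%R).
  { apply (absorb h T Y _ j); try easy; fold V.
    rewrite Hjz, HTe.
    assert (Cmod (2 * c (S m) - conv (divX a) (divX a) (S m) - ps1 m) <=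
      2 * Y + V + 0)%R.
    { repeat (apply Cmod_minus_le || apply Cmod_plus_le || apply Cmod_mult_le);
        auto; try apply Rle_refl; apply Hcst; lra. }
    generalize (Hhz (a (S (S (S m))))) (Hmz (a (S (S (S m))))); lra. }
  assert (Rb : (Cmod (b (S (S (S m)))) <= Y)%R).
  { apply (absorb h T Y _ j); try easy; fold V.
    rewrite Hjz, HTe.
    assert (Cmod (-2 * (a (S (S (S m))) * b O + conv (divX a) (divX b) (S m))) <=
      2 * (Y * Cmod (b O) + V))%R.
    { repeat (apply Cmod_minus_le || apply Cmod_plus_le || apply Cmod_mult_le);
        auto; try apply Rle_refl; apply Hcst; lra. }
    generalize (Hhz (b (S (S (S m))))) (Hmz (b (S (S (S m))))); lra. }
  assert (Re : (Cmod (e (S (S (S m)))) <= Y)%R).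
  { apply (absorb h T Y _ j); try easy; fold V.
    rewrite Hjz, HTe.
    assert (Cmod (4 * (a (S (S (S m))) * e O + conv (divX a) (divX e) (S m))) <=
      4 * (Y * Cmod (e O) + V))%R.
    { repeat (apply Cmod_minus_le || apply Cmod_plus_le || apply Cmod_mult_le);
        auto; try apply Rle_refl; apply Hcst; lra. }
    generalize (Hhz (e (S (S (S m))))) (Hmz (e (S (S (S m))))); lra. }
  assert (Rd : (Cmod (d (S (S (S m)))) <= Y)%R).
  { apply (absorb h T Y _ j); try easy; fold V.
    rewrite Hjz, HTe.
    assert (Cmod (2 * (a (S (S (S m))) * d O + conv (divX a) (divX d) (S m))
      - t2 * mulX e m) <= 2 * (Y * Cmod (d O) + V) + Cmod t2 * Y)%R.
    { repeat (apply Cmod_minus_le || apply Cmod_plus_le || apply Cmod_mult_le);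
        auto; try apply Rle_refl; apply Hcst; lra. }
    generalize (Hhz (d (S (S (S m))))) (Hmz (d (S (S (S m))))); lra. }
  assert (Rc : (Cmod (c (S (S (S m)))) <= Y)%R).
  { apply (absorb h T Y _ j); try easy; fold V.
    rewrite Hjz, HTe.
    assert (Cmod (2 * (a (S (S (S m))) * c O + conv (divX a) (divX c) (S m)) +
      2 * (d (S (S (S m))) * b O + d O * b (S (S (S m)))
        + conv (divX d) (divX b) (S m))) <= 2 * (Y * Cmod (c O) + V) +
      2 * (Y * Cmod (b O) + Cmod (d O) * Y + V))%R.
    { repeat (apply Cmod_minus_le || apply Cmod_plus_le || apply Cmod_mult_le);
        auto; try apply Rle_refl; apply Hcst; lra. }
    generalize (Hhz (c (S (S (S m))))) (Hmz (c (S (S (S m))))); lra. }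
  easy. }
(* The small constant h/24 serves positive indices only; adding [m0 0] covers the leading
   coefficients. *)
exists (h / 24 + m0 O)%R, K.
assert (H0 : (0 <= m0 O)%R).
{ unfold m0; generalize (Hpos (a O)) (Hpos (b O)) (Hpos (c O)) (Hpos (d O))
    (Hpos (e O)); lra. }
assert (G : forall f : nat -> C, (Cmod (f O) <= m0 O)%R ->
  (forall n, (1 <= n)%nat -> (Cmod (f n) <= h / 24 * K ^ n)%R) ->
  geometric (h / 24 + m0 O) K f).
{ intros f Hf0 Hf [|n].
  - simpl; lra.
  - apply Rle_trans with (1 := Hf (S n) ltac:(lia)), Rmult_le_compat_r;
      [generalize (HKp (S n))|]; lra. }
generalize (Hpos (a O)) (Hpos (b O)) (Hpos (c O)) (Hpos (d O)) (Hpos (e O)).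
intros.
repeat split; try lra; apply G; try (intros n Hn; now apply B);
  unfold m0; lra.
Qed.

(** * Sums of power series *)

Notation is_power_sum :=
  (is_pseries (K := C_AbsRing) (V := C_NormedModule)) (only parsing).

(* [sum_n] is an element of the carrier of a structure; [ring] needs the type
   [C] itself. *)
Ltac eq_in_C := match goal with |- ?x = ?y => change (@eq C x y) end.

Lemma pow_n_Cpow (x : C) (n : nat) : pow_n (K := C_AbsRing) x n = x ^ n.
Proof.
induction n as [|n IH]; [easy|].
change (x * pow_n (K := C_AbsRing) x n = x * x ^ n); now rewrite IH.
Qed.

Definition partial_sum (a : nat -> C) (s : C) (n : nat) : C :=
  sum_n (fun k => s ^ k * a k) n.

Lemma partial_sum_S (a : nat -> C) (s : C) (n : nat) :
  partial_sum a s (S n) = partial_sum a s n + s ^ S n * a (S n).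
Proof. unfold partial_sum; now rewrite sum_Sn. Qed.

Lemma is_power_sum_iff (a : nat -> C) (s l : C) :
  is_power_sum a s l <->
  forall eps : posreal, exists N, forall n, (N <= n)%nat ->
    (Cmod (partial_sum a s n - l) < eps)%R.
Proof.
transitivity (is_series (K := C_AbsRing) (V := C_NormedModule)
  (fun k => s ^ k * a k) l).
{ split; apply is_series_ext; intros n; [|symmetry];
  exact (f_equal (fun z => z * a n) (pow_n_Cpow s n)). }
exact (filterlim_locally_ball_norm (K := C_AbsRing) (U := C_NormedModule)
  (F := eventually) (partial_sum a s) l).
Qed.

Lemma half_pow_pos (n : nat) : (0 < (1 / 2) ^ n)%R.
Proof. apply pow_lt; lra. Qed.

Lemma half_pow_small (M : R) (eps : posreal) :
  exists N, forall n, (N <= n)%nat -> (M * (1 / 2) ^ n < eps)%R.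
Proof.
assert (HM : (0 < Rabs M + 1)%R) by (generalize (Rabs_pos M); lra).
destruct (pow_lt_1_zero (1 / 2) ltac:(rewrite Rabs_pos_eq; lra)
  (eps / (Rabs M + 1)) ltac:(apply Rdiv_lt_0_compat; [apply eps|easy]))
  as [N HN].
exists N; intros n Hn; generalize (HN n Hn) (half_pow_pos n).
intros H Hp; rewrite Rabs_pos_eq in H by lra.
apply Rle_lt_trans with ((1 / 2) ^ n * (Rabs M + 1))%R.
- rewrite Rmult_comm; apply Rmult_le_compat_l; [lra|].
  generalize (Rle_abs M); lra.
- apply Rmult_lt_reg_r with (/ (Rabs M + 1))%R; [now apply Rinv_0_lt_compat|].
  rewrite Rmult_assoc, Rinv_r, Rmult_1_r by lra; exact H.
Qed.

Lemma power_sum_of_rate (a : nat -> C) (s l : C) (M : R) :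
  (forall n, (Cmod (partial_sum a s n - l) <= M * (1 / 2) ^ n)%R) ->
  is_power_sum a s l.
Proof.
intros H; apply is_power_sum_iff; intros eps.
destruct (half_pow_small M eps) as [N HN].
exists N; intros n Hn; apply Rle_lt_trans with (1 := H n), HN, Hn.
Qed.

(** For q at most 1/2 a term bounded by [M q^(k+1)] is at most [M q^k - M q^(k+1)], so the tail
    telescopes and no factor 1 / (1 - q) appears. *)
Lemma power_sum_rate (a : nat -> C) (s l : C) (M q : R) :
  (0 < q <= 1 / 2)%R ->
  (forall k, (Cmod (s ^ k * a k) <= M * q ^ k)%R) ->
  is_power_sum a s l ->
  forall n, (Cmod (partial_sum a s n - l) <= M * q ^ n)%R.
Proof.
intros Hq Ha Hl n; set (P := partial_sum a s).
assert (HM : (0 <= M)%R).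
{ apply Rle_trans with (1 := Cmod_ge_0 (s ^ 0 * a O)).
  apply Rle_trans with (1 := Ha O); simpl; lra. }
assert (HMq : forall k, (0 <= M * q ^ k)%R)
  by (intros k; apply Rmult_le_pos; [easy|apply pow_le; lra]).
assert (H : forall p, (Cmod (P n - P (p + n)%nat) <=
    M * q ^ n - M * q ^ (p + n))%R).
{ induction p as [|p IH].
  - simpl; replace (P n - P n) with (RtoC 0) by ring; rewrite Cmod_0; lra.
  - replace (P n - P (S p + n)%nat) with
      ((P n - P (p + n)%nat) - s ^ (S p + n) * a (S p + n)%nat).
    + apply Rle_trans with (1 := Cmod_minus_le _ _ _ _ IH (Ha (S p + n)%nat)).
      simpl; generalize (HMq (p + n)%nat); intros Hk.
      assert (q * (M * q ^ (p + n)) <= 1 / 2 * (M * q ^ (p + n)))%R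
        by (apply Rmult_le_compat_r; lra).
      lra.
    + unfold P; cbn [Nat.add]; rewrite partial_sum_S; ring. }
apply Rnot_lt_le; intros Hlt.
destruct (proj1 (is_power_sum_iff a s l) Hl
  (mkposreal _ (proj2 (Rlt_0_minus _ _) Hlt))) as [N HN].
generalize (HN (N + n)%nat ltac:(lia)) (H N); simpl; fold P; intros H1 H2.
assert (H3 : P n - l = (P n - P (N + n)%nat) + (P (N + n)%nat - l)) by ring.
generalize (Cmod_triangle (P n - P (N + n)%nat) (P (N + n)%nat - l)).
rewrite <- H3; generalize (HMq (N + n)%nat); lra.
Qed.

Lemma power_sum_exists (a : nat -> C) (s : C) (M : R) :
  (forall k, (Cmod (s ^ k * a k) <= M * (1 / 2) ^ k)%R) ->
  exists l, is_power_sum a s l.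
Proof.
intros H.
apply (ex_series_le (K := C_AbsRing) (V := C_CompleteNormedModule) _
  (fun k => M * (1 / 2) ^ k)%R).
- intros k; apply Rle_trans with (2 := H k); right.
  exact (f_equal (fun z => Cmod (z * a k)) (pow_n_Cpow s k)).
- apply (ex_series_scal (K := R_AbsRing) (V := R_NormedModule)).
  apply ex_series_geom; rewrite Rabs_pos_eq; lra.
Qed.

Lemma power_sum_unique (a : nat -> C) (s l l' : C) :
  is_power_sum a s l -> is_power_sum a s l' -> l = l'.
Proof.
apply (filterlim_locally_unique (F := eventually) (V := C_NormedModule)).
Qed.

Lemma power_sum_ext (a b : nat -> C) (s l : C) :
  (forall n, a n = b n) -> is_power_sum a s l -> is_power_sum b s l.
Proof. intros H; apply is_series_ext; intros n; now rewrite H. Qed.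

Lemma power_sum_lin (x y : C) (a b : nat -> C) (s la lb : C) :
  is_power_sum a s la -> is_power_sum b s lb ->
  is_power_sum (fun k => x * a k + y * b k) s (x * la + y * lb).
Proof.
intros Ha Hb.
apply (is_pseries_scal (K := C_AbsRing) x) in Ha; [|apply Cmult_comm].
apply (is_pseries_scal (K := C_AbsRing) y) in Hb; [|apply Cmult_comm].
exact (is_pseries_plus _ _ _ _ _ Ha Hb).
Qed.

Lemma power_sum_mulX (a : nat -> C) (s l : C) :
  is_power_sum a s l -> is_power_sum (mulX a) s (s * l).
Proof.
intros H; apply is_pseries_incr_1 in H.
revert H; apply power_sum_ext; now intros [|n].
Qed.

Lemma power_sum_ps1 (s : C) : is_power_sum ps1 s (RtoC 1).
Proof.
apply power_sum_of_rate with 0%R; intros n.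
replace (partial_sum ps1 s n) with (RtoC 1).
- replace (1 - 1) with (RtoC 0) by ring; rewrite Cmod_0; lra.
- induction n as [|n IH].
  + unfold partial_sum; rewrite sum_O; simpl; ring.
  + rewrite partial_sum_S, <- IH; simpl; ring.
Qed.

Lemma geometric_term (M K q : R) (a : nat -> C) (s : C) :
  (0 <= K)%R -> geometric M K a -> (Cmod s * K <= q)%R ->
  forall k, (Cmod (s ^ k * a k) <= M * q ^ k)%R.
Proof.
intros HK Ha Hs k.
assert (HM : (0 <= M)%R).
{ apply Rle_trans with (1 := Cmod_ge_0 (a O)).
  apply Rle_trans with (1 := Ha O); simpl; lra. }
rewrite Cmod_mult, Cmod_pow.
apply Rle_trans with (Cmod s ^ k * (M * K ^ k))%R.
- apply Rmult_le_compat_l; [apply pow_le, Cmod_ge_0|apply Ha].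
- replace (Cmod s ^ k * (M * K ^ k))%R with (M * (Cmod s * K) ^ k)%R
    by (rewrite Rpow_mult_distr; ring).
  apply Rmult_le_compat_l; [easy|apply pow_incr; split; [|easy]].
  apply Rmult_le_pos; [apply Cmod_ge_0|easy].
Qed.

(** Taking partial sums is convolution with the constant sequence 1, so it may be moved onto one
    factor. *)
Lemma sum_n_conv (u v : nat -> C) (n : nat) :
  sum_n (conv u v) n = conv u (sum_n v) n.
Proof.
induction n as [|n IH].
- rewrite sum_O, !conv_0, sum_O; reflexivity.
- rewrite sum_Sn, IH, (conv_S_r u (sum_n v)), (conv_S_r u v), sum_O.
  eq_in_C.
  rewrite (conv_ext u u (divX (sum_n v)) (fun k => 1 * sum_n v k + 1 * divX v k)).
  + rewrite conv_lin_r; change (@plus _ ?x ?y) with (x + y); ring.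
  + easy.
  + intros k _; unfold divX; rewrite sum_Sn.
    eq_in_C.
    change (@plus _ ?x ?y) with (x + y); ring.
Qed.

Lemma conv_const_r (u : nat -> C) (x : C) (n : nat) :
  conv u (fun _ => x) n = sum_n u n * x.
Proof. exact (sum_n_mult_r (K := C_Ring) x u n). Qed.

Lemma conv_pow (a b : nat -> C) (s : C) (n : nat) :
  s ^ n * conv a b n = conv (fun k => s ^ k * a k) (fun k => s ^ k * b k) n.
Proof.
unfold conv; transitivity (sum_n (fun i => s ^ n * (a i * b (n - i)%nat)) n).
- symmetry; exact (sum_n_mult_l (K := C_Ring) (s ^ n) _ n).
- apply sum_n_ext_loc; intros k Hk; eq_in_C.
  replace (s ^ n) with (s ^ k * s ^ (n - k)); [ring|].
  rewrite <- Cpow_add_r; f_equal; lia.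
Qed.

Lemma INR_lt_pow2 (n : nat) : (INR n + 1 <= 2 ^ n)%R.
Proof.
induction n as [|n IH]; [simpl; lra|].
rewrite S_INR; simpl; generalize (pos_INR n); lra.
Qed.

(** Mertens' splitting: the error is the convolution of the terms of [a] with the tails of [b], plus
    the tail of [a] times [lb]. The convolution costs a factor n + 1, at most 2^n, whence ratio 1/4
    in the hypotheses and 1/2 in the result. *)
Lemma power_sum_conv (M N : R) (a b : nat -> C) (s la lb : C) :
  (forall k, (Cmod (s ^ k * a k) <= M * (1 / 4) ^ k)%R) ->
  (forall k, (Cmod (s ^ k * b k) <= N * (1 / 4) ^ k)%R) ->
  is_power_sum a s la -> is_power_sum b s lb ->
  is_power_sum (conv a b) s (la * lb).
Proof.
intros Ha Hb Hla Hlb.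
assert (Ra : forall n, (Cmod (partial_sum a s n - la) <= M * (1 / 4) ^ n)%R)
  by (apply power_sum_rate; auto; lra).
assert (Rb : forall n, (Cmod (partial_sum b s n - lb) <= N * (1 / 4) ^ n)%R)
  by (apply power_sum_rate; auto; lra).
apply power_sum_of_rate with (M * N + M * Cmod lb)%R; intros n.
assert (E : partial_sum (conv a b) s n - la * lb =
  conv (fun k => s ^ k * a k) (fun k => partial_sum b s k - lb) n
  + (partial_sum a s n - la) * lb).
{ unfold partial_sum at 1.
  rewrite (sum_n_ext _ (conv (fun k => s ^ k * a k) (fun k => s ^ k * b k)))
    by (intros k; apply conv_pow).
  rewrite sum_n_conv.
  rewrite (conv_ext (fun k => s ^ k * a k) (fun k => s ^ k * a k)
    (fun k => partial_sum b s k - lb)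
    (fun k => 1 * partial_sum b s k + (-1) * lb)) by (intros; ring).
  rewrite conv_lin_r, (conv_const_r _ lb).
  fold (partial_sum b s) (partial_sum a s n).
  change (fun k => partial_sum b s k) with (partial_sum b s).
  change (sum_n (fun k => s ^ k * b k)) with (partial_sum b s).
  ring. }
rewrite E.
assert (HM : (0 <= M)%R).
{ apply Rle_trans with (1 := Cmod_ge_0 (s ^ 0 * a O)).
  apply Rle_trans with (1 := Ha O); simpl; lra. }
assert (HN : (0 <= N)%R).
{ apply Rle_trans with (1 := Cmod_ge_0 (s ^ 0 * b O)).
  apply Rle_trans with (1 := Hb O); simpl; lra. }
assert (H4 : ((1 / 4) ^ n = (1 / 2) ^ n * (1 / 2) ^ n)%R)
  by (rewrite <- Rpow_mult_distr; f_equal; lra).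
assert (H2 : (2 ^ n * (1 / 2) ^ n = 1)%R).
{ rewrite <- Rpow_mult_distr; replace (2 * (1 / 2))%R with 1%R by lra.
  apply pow1. }
assert (H5 : ((INR n + 1) * (1 / 4) ^ n <= (1 / 2) ^ n)%R).
{ rewrite H4; apply Rle_trans with (2 ^ n * ((1 / 2) ^ n * (1 / 2) ^ n))%R.
  - apply Rmult_le_compat_r; [|apply INR_lt_pow2].
    apply Rmult_le_pos; apply Rlt_le, half_pow_pos.
  - rewrite <- Rmult_assoc, H2; lra. }
assert (H6 : ((1 / 4) ^ n <= (1 / 2) ^ n)%R) by (apply pow_incr; lra).
replace ((M * N + M * Cmod lb) * (1 / 2) ^ n)%R with
  (M * N * (1 / 2) ^ n + M * (1 / 2) ^ n * Cmod lb)%R by ring.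
apply Cmod_plus_le.
- apply Rle_trans with ((INR n + 1) * (M * N * (1 / 4) ^ n))%R.
  + apply Cmod_conv_le; auto.
  + replace ((INR n + 1) * (M * N * (1 / 4) ^ n))%R with
      (M * N * ((INR n + 1) * (1 / 4) ^ n))%R by ring.
    apply Rmult_le_compat_l; [now apply Rmult_le_pos|easy].
- apply Cmod_mult_le; [|apply Rle_refl].
  apply Rle_trans with (1 := Ra n), Rmult_le_compat_l; easy.
Qed.

(** * Complex derivatives *)

(** Converts the filter definition of the derivative into an estimate in [Cmod]; a quadratic
    remainder is little-o of [w - z]. *)
Lemma is_Cderive_quadratic (f : C -> C) (z l : C) (M delta : R) :
  (0 < delta)%R ->
  (forall w, (Cmod (w - z) < delta)%R ->
     (Cmod (f w - f z - (w - z) * l) <= M * Cmod (w - z) ^ 2)%R) ->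
  is_Cderive f z l.
Proof.
intros Hd H; split; [apply is_linear_scal_l|].
intros x Hx.
apply (is_filter_lim_locally_unique (K := C_AbsRing)
  (V := AbsRing_NormedModule C_AbsRing)) in Hx as <-.
intros eps.
assert (HM : (0 < Rabs M + 1)%R) by (generalize (Rabs_pos M); lra).
assert (Heps : (0 < eps / (Rabs M + 1))%R)
  by (apply Rdiv_lt_0_compat; [apply eps|easy]).
exists (mkposreal (Rmin delta (eps / (Rabs M + 1))) (Rmin_pos _ _ Hd Heps)).
intros w Hw.
change (Cmod (w - z) < Rmin delta (eps / (Rabs M + 1)))%R in Hw.
change (Cmod (f w - f z - (w - z) * l) <= eps * Cmod (w - z))%R.
apply Rle_trans with (1 := H w (Rlt_le_trans _ _ _ Hw (Rmin_l _ _))).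
simpl; rewrite Rmult_1_r, <- Rmult_assoc.
apply Rmult_le_compat_r; [apply Cmod_ge_0|].
apply Rle_trans with ((Rabs M + 1) * Cmod (w - z))%R.
- apply Rmult_le_compat_r; [apply Cmod_ge_0|generalize (Rle_abs M); lra].
- apply Rle_trans with ((Rabs M + 1) * (eps / (Rabs M + 1)))%R.
  + apply Rmult_le_compat_l; [lra|].
    apply Rlt_le, Rlt_le_trans with (1 := Hw), Rmin_r.
  + right; field; lra.
Qed.

(* [C_NormedModule] carries the product topology and [C_AbsRing] that of the
   modulus; the underlying norms coincide. *)
Lemma is_Cderive_AbsRing (f : C -> C) (z l : C) :
  is_Cderive f z l <->
  is_derive (K := C_AbsRing) (V := AbsRing_NormedModule C_AbsRing) f z l.
Proof.
split; intros [[H1 H2 H3] H4];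
  (split; [split; [exact H1|exact H2|exact H3]|exact H4]).
Qed.

Lemma is_Cderive_eq (f g : C -> C) (z l l' : C) :
  (forall x, f x = g x) -> l = l' -> is_Cderive f z l -> is_Cderive g z l'.
Proof. intros H <-; now apply is_derive_ext. Qed.

Lemma is_Cderive_const (x z : C) : is_Cderive (fun _ => x) z 0.
Proof. apply (is_derive_const (K := C_AbsRing) (V := C_NormedModule)). Qed.

Lemma is_Cderive_id (z : C) : is_Cderive (fun x => x) z 1.
Proof. apply is_Cderive_AbsRing, (is_derive_id (K := C_AbsRing)). Qed.

Lemma is_Cderive_plus (f g : C -> C) (z l l' : C) :
  is_Cderive f z l -> is_Cderive g z l' ->
  is_Cderive (fun x => f x + g x) z (l + l').
Proof. apply (is_derive_plus (K := C_AbsRing) (V := C_NormedModule)). Qed.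

Lemma is_Cderive_minus (f g : C -> C) (z l l' : C) :
  is_Cderive f z l -> is_Cderive g z l' ->
  is_Cderive (fun x => f x - g x) z (l - l').
Proof. apply (is_derive_minus (K := C_AbsRing) (V := C_NormedModule)). Qed.

Lemma is_Cderive_mult (f g : C -> C) (z l l' : C) :
  is_Cderive f z l -> is_Cderive g z l' ->
  is_Cderive (fun x => f x * g x) z (l * g z + f z * l').
Proof.
rewrite !is_Cderive_AbsRing; intros Hf Hg.
apply (is_derive_mult (K := C_AbsRing)); auto; apply Cmult_comm.
Qed.

Lemma is_Cderive_comp (f g : C -> C) (z l l' : C) :
  is_Cderive f (g z) l -> is_Cderive g z l' ->
  is_Cderive (fun x => f (g x)) z (l' * l).
Proof.
rewrite (is_Cderive_AbsRing g).
apply (is_derive_comp (K := C_AbsRing) (V := C_NormedModule)).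
Qed.

(** The remainder is exactly [(w - z)^2 / (w z^2)], and [w] has modulus at least half that of [z]
    nearby. *)
Lemma is_Cderive_inv (z : C) : z <> 0 -> is_Cderive (fun x => / x) z (- / z ^ 2).
Proof.
intros Hz; assert (Hz0 : (0 < Cmod z)%R) by now apply Cmod_gt_0.
apply (is_Cderive_quadratic _ _ _ (2 / Cmod z ^ 3) (Cmod z / 2)); [lra|].
intros w Hw.
assert (Hw2 : (Cmod z / 2 <= Cmod w)%R).
{ generalize (Cmod_triangle w (z - w)).
  replace (w + (z - w)) with z by ring.
  rewrite <- (Cmod_opp (z - w)); replace (- (z - w)) with (w - z) by ring; lra. }
assert (Hw0 : w <> 0) by (apply Cmod_gt_0; lra).
replace (/ w - / z - (w - z) * - / z ^ 2) with
  (/ (w * z ^ 2) * (w - z) ^ 2) by (field; now split).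
rewrite Cmod_mult, Cmod_pow; apply Rmult_le_compat_r.
- apply pow_le, Cmod_ge_0.
- rewrite Cmod_inv, Cmod_mult, Cmod_pow
    by (apply Cmult_neq_0; [easy|now apply Cpow_nz]).
  replace (2 / Cmod z ^ 3)%R with (/ (Cmod z / 2 * Cmod z ^ 2))%R
    by (field; lra).
  apply Rinv_le_contravar.
  + apply Rmult_lt_0_compat; [lra|now apply pow_lt].
  + apply Rmult_le_compat_r; [apply pow_le; lra|easy].
Qed.

(** A total function of [s], with an unspecified value where the series diverges. *)
Definition power_sum (a : nat -> C) (s : C) : C :=
  epsilon (inhabits (RtoC 0)) (fun l => is_power_sum a s l).

Lemma power_sum_correct (M K : R) (a : nat -> C) (s : C) :
  (0 <= K)%R -> geometric M K a -> (Cmod s * K <= 1 / 2)%R ->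
  is_power_sum a s (power_sum a s).
Proof.
intros HK Ha Hs; unfold power_sum; apply epsilon_spec.
apply power_sum_exists with M; now apply geometric_term with K.
Qed.

Lemma geometric_theta (M K : R) (a : nat -> C) :
  (0 <= K)%R -> geometric M K a -> geometric M (2 * K) (theta a).
Proof.
intros HK Ha n; unfold theta; rewrite Rpow_mult_distr.
replace (M * (2 ^ n * K ^ n))%R with (2 ^ n * (M * K ^ n))%R by ring.
apply Cmod_mult_le; [|apply Ha].
rewrite Cmod_R, Rabs_pos_eq by apply pos_INR.
generalize (INR_lt_pow2 n); lra.
Qed.

(** The derivative is written [k z^k / z] to match [theta] and avoid the exponent k - 1. Multiplying
    the remainder by [w] reproduces the next one up to [(w - z)^2 / z * (k z^k)], and
    [4^k + k <= 4 * 4^k] closes the induction. *)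
Lemma pow_quadratic_remainder (z w : C) (R0 : R) (k : nat) :
  z <> 0 -> (0 < R0)%R -> (Cmod z <= R0)%R -> (Cmod w <= R0)%R ->
  (Cmod (w ^ k - z ^ k - (w - z) / z * (RtoC (INR k) * z ^ k)) <=
   Cmod (w - z) ^ 2 / (R0 * Cmod z) * (4 * R0) ^ k)%R.
Proof.
intros Hz HR Hzr Hwr.
assert (Hz0 : (0 < Cmod z)%R) by now apply Cmod_gt_0.
set (Q := (Cmod (w - z) ^ 2 / (R0 * Cmod z))%R).
assert (HQ : (0 <= Q)%R).
{ apply Rdiv_le_0_compat; [apply pow_le, Cmod_ge_0|].
  now apply Rmult_lt_0_compat. }
induction k as [|k IH].
- simpl; replace (1 - 1 - (w - z) / z * (0 * 1)) with (RtoC 0) by now field.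
  rewrite Cmod_0; lra.
- replace (w ^ S k - z ^ S k - (w - z) / z * (RtoC (INR (S k)) * z ^ S k)) with
    (w * (w ^ k - z ^ k - (w - z) / z * (RtoC (INR k) * z ^ k))
     + (w - z) ^ 2 / z * (RtoC (INR k) * z ^ k))
    by (rewrite RtoC_INR_S; simpl; now field).
  apply Rle_trans with (R0 * (Q * (4 * R0) ^ k) + Q * R0 * (INR k * R0 ^ k))%R.
  + apply Cmod_plus_le; [now apply Cmod_mult_le|].
    apply Cmod_mult_le; [|apply Cmod_mult_le].
    * rewrite Cmod_div, Cmod_pow by easy; right; unfold Q; field; lra.
    * rewrite Cmod_R, Rabs_pos_eq; [lra|apply pos_INR].
    * rewrite Cmod_pow; apply pow_incr; split; [lra|easy].
  + rewrite Rpow_mult_distr; simpl.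
    replace (R0 * (Q * (4 ^ k * R0 ^ k)) + Q * R0 * (INR k * R0 ^ k))%R with
      (Q * R0 * R0 ^ k * (4 ^ k + INR k))%R by ring.
    replace (Q * (4 * R0 * (4 * R0) ^ k))%R with
      (Q * R0 * R0 ^ k * (4 * 4 ^ k))%R by (rewrite Rpow_mult_distr; ring).
    apply Rmult_le_compat_l.
    * apply Rmult_le_pos; [apply Rmult_le_pos; lra|apply pow_le; lra].
    * assert (2 ^ k <= 4 ^ k)%R by (apply pow_incr; lra).
      generalize (INR_lt_pow2 k) (pos_INR k); lra.
Qed.

(** The remainders of the monomials are summed. With R0 = 1 / (8 K) their bounds [(4 R0)^k K^k] are
    (1/2)^k, hence summable. *)
Lemma is_Cderive_power_sum (M K : R) (a : nat -> C) (z : C) :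
  (0 < K)%R -> geometric M K a -> z <> 0 -> (Cmod z < / (8 * K))%R ->
  is_Cderive (power_sum a) z (power_sum (theta a) z / z).
Proof.
intros HK Ha Hz HzR; set (R0 := (/ (8 * K))%R) in *.
assert (HR : (0 < R0)%R) by (apply Rinv_0_lt_compat; lra).
assert (HRK : (R0 * K = 1 / 8)%R) by (unfold R0; field; lra).
assert (Hz0 : (0 < Cmod z)%R) by now apply Cmod_gt_0.
assert (HsK : forall s, (Cmod s <= R0)%R -> (Cmod s * K <= 1 / 8)%R).
{ intros s Hs; rewrite <- HRK; apply Rmult_le_compat_r; lra. }
assert (HM : (0 <= M)%R).
{ apply Rle_trans with (1 := Cmod_ge_0 (a O)).
  apply Rle_trans with (1 := Ha O); simpl; lra. }
assert (Rate : forall b s, geometric M (2 * K) b -> (Cmod s <= R0)%R ->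
  forall n, (Cmod (partial_sum b s n - power_sum b s) <= M * (1 / 2) ^ n)%R).
{ intros b s Hb Hs; apply power_sum_rate; [lra| |].
  - apply geometric_term with (2 * K)%R; [lra|easy|].
    generalize (HsK s Hs); lra.
  - apply power_sum_correct with M (2 * K)%R; [lra|easy|].
    generalize (HsK s Hs); lra. }
assert (Ha2 : geometric M (2 * K) a).
{ intros n; apply Rle_trans with (1 := Ha n), Rmult_le_compat_l; [easy|].
  apply pow_incr; lra. }
apply (is_Cderive_quadratic _ _ _ (2 * M / (R0 * Cmod z)) (R0 - Cmod z)); [lra|].
intros w Hw.
assert (HwR : (Cmod w <= R0)%R).
{ generalize (Cmod_triangle (w - z) z).
  replace (w - z + z) with w by ring; lra. }
set (Q := (Cmod (w - z) ^ 2 / (R0 * Cmod z))%R).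
assert (HQ : (0 <= Q)%R).
{ apply Rdiv_le_0_compat; [apply pow_le, Cmod_ge_0|].
  now apply Rmult_lt_0_compat. }
replace (2 * M / (R0 * Cmod z) * Cmod (w - z) ^ 2)%R with (2 * (M * Q))%R
  by (unfold Q; field; lra).
set (D n := partial_sum a w n - partial_sum a z n
            - (w - z) / z * partial_sum (theta a) z n).
(* A bound on the truncated remainder that never exceeds [2 M Q], in a form that absorbs the next
   term (1/2)^(n+1) exactly. *)
assert (HD : forall n, (Cmod (D n) <= M * Q * (2 - (1 / 2) ^ n))%R).
{ induction n as [|n IH].
  - unfold D, partial_sum, theta; rewrite !sum_O; simpl.
    replace (1 * a O - 1 * a O - (w - z) / z * (1 * (0 * a O)))
      with (RtoC 0) by now field.
    rewrite Cmod_0; generalize (Rmult_le_pos _ _ HM HQ); lra.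
  - replace (D (S n)) with (D n +
      (w ^ S n - z ^ S n - (w - z) / z * (RtoC (INR (S n)) * z ^ S n)) * a (S n))
      by (unfold D; rewrite !partial_sum_S; unfold theta; ring).
    apply Rle_trans with
      (M * Q * (2 - (1 / 2) ^ n) + Q * (4 * R0) ^ S n * (M * K ^ S n))%R.
    + apply Cmod_plus_le; [exact IH|apply Cmod_mult_le; [|apply Ha]].
      apply pow_quadratic_remainder; auto; lra.
    + replace (Q * (4 * R0) ^ S n * (M * K ^ S n))%R with
        (M * Q * ((4 * R0) ^ S n * K ^ S n))%R by ring.
      rewrite <- Rpow_mult_distr.
      replace (4 * R0 * K)%R with (1 / 2)%R by lra.
      simpl; right; field. }
set (L := power_sum a w - power_sum a z - (w - z) * (power_sum (theta a) z / z)).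
(* Passage to the limit: otherwise the truncation errors, which tend to 0, would have to fill a
   fixed positive gap. *)
apply Rnot_lt_le; intros Hlt.
destruct (half_pow_small (2 * M + Cmod ((w - z) / z) * M)
  (mkposreal _ (proj2 (Rlt_0_minus _ _) Hlt))) as [N HN].
generalize (HN N (le_n N)); simpl; apply Rle_not_lt.
assert (E : L = D N - (partial_sum a w N - power_sum a w)
  + (partial_sum a z N - power_sum a z)
  + (w - z) / z * (partial_sum (theta a) z N - power_sum (theta a) z))
  by (unfold L, D; now field).
assert (HL : (Cmod L <= M * Q * (2 - (1 / 2) ^ N) + M * (1 / 2) ^ N
  + M * (1 / 2) ^ N + Cmod ((w - z) / z) * (M * (1 / 2) ^ N))%R).
{ rewrite E; apply Cmod_plus_le; [apply Cmod_plus_le; [apply Cmod_minus_le|]|].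
  - apply HD.
  - now apply Rate.
  - apply Rate; [easy|lra].
  - apply Cmod_mult_le; [apply Rle_refl|].
    apply Rate; [apply geometric_theta; [lra|easy]|lra]. }
assert (0 <= M * Q * (1 / 2) ^ N)%R.
{ apply Rmult_le_pos; [now apply Rmult_le_pos|].
  apply Rlt_le, half_pow_pos. }
lra.
Qed.

(** * Summing the formal solution *)

(** [H1] has degree at most 2 in each of [p1], [p2], [q1], and is affine in [q2] apart from
    [t2 / q2], so this one rule serves all four partial derivatives. *)
Lemma is_Cderive_quad (x y w z : C) :
  is_Cderive (fun u => x * (u * u) + y * u + w) z (2 * x * z + y).
Proof.
eapply is_Cderive_eq; [reflexivity| |apply is_Cderive_plus;
  [apply is_Cderive_plus; (apply is_Cderive_mult; [apply is_Cderive_const|])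
  |apply is_Cderive_const]].
2: apply is_Cderive_mult; apply is_Cderive_id.
2: apply is_Cderive_id.
cbv beta; ring.
Qed.

Lemma H1_partial_derivatives (t2 t q1 q2 p1 p2 : C) : q2 <> 0 ->
  is_Cderive (fun x => H1 t2 t q1 q2 x p2) p1 (2 * p1 - (q1 ^ 2 + t)) /\
  is_Cderive (fun x => H1 t2 t q1 q2 p1 x) p2 (- 2 * q1 * q2) /\
  is_Cderive (fun x => H1 t2 t x q2 p1 p2) q1 (- (2 * q1 * p1 + 2 * p2 * q2)) /\
  is_Cderive (fun x => H1 t2 t q1 x p1 p2) q2
    (- (2 * q1 * p2 + 1 - t2 / q2 ^ 2)).
Proof.
intros Hq; unfold H1; split; [|split; [|split]].
- eapply is_Cderive_eq; [| |apply (is_Cderive_quad 1 (- (q1 ^ 2 + t))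
    (- 2 * p2 * q1 * q2 - q2 - t2 / q2))]; [intros x; simpl|simpl]; ring.
- eapply is_Cderive_eq; [| |apply (is_Cderive_quad 0 (- 2 * q1 * q2)
    (p1 ^ 2 - (q1 ^ 2 + t) * p1 - q2 - t2 / q2))]; [intros x; simpl|simpl]; ring.
- eapply is_Cderive_eq; [| |apply (is_Cderive_quad (- p1) (- 2 * p2 * q2)
    (p1 ^ 2 - t * p1 - q2 - t2 / q2))]; [intros x; simpl|simpl]; ring.
- eapply is_Cderive_eq; [| |apply is_Cderive_minus;
    [apply (is_Cderive_quad 0 (- 2 * p2 * q1 - 1) (p1 ^ 2 - (q1 ^ 2 + t) * p1))
    |apply is_Cderive_mult; [apply (is_Cderive_const t2)
                            |apply is_Cderive_inv, Hq]]].
  + intros x; cbv beta; unfold Cdiv; ring.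
  + cbv beta; field; exact Hq.
Qed.

Lemma Cinv_neq_0 (z : C) : z <> 0 -> / z <> 0.
Proof.
intros Hz H; apply C1_nz; rewrite <- (Cinv_r z Hz), H; ring.
Qed.

Lemma is_Cderive_shift (f : C -> C) (alpha t l : C) :
  is_Cderive f (t - alpha) l -> is_Cderive (fun x => f (x - alpha)) t l.
Proof.
intros H.
apply (is_Cderive_eq (fun x => f (x - alpha)) _ _ ((1 - 0) * l)); [easy|ring|].
apply (is_Cderive_comp f (fun x => x - alpha)); [exact H|].
apply is_Cderive_minus; [apply is_Cderive_id|apply is_Cderive_const].
Qed.

(** Each equation holds because its two sides are sums of one and the same power series, by the
    coefficient identities. *)
Lemma power_sum_equations (hbar t2 alpha : C) (a b c d e : nat -> C)
    (M K : R) (s : C) :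
  (0 < K)%R -> geometric M K a -> geometric M K b -> geometric M K c ->
  geometric M K d -> geometric M K e ->
  quadratic_system hbar t2 alpha a b c d e ->
  (forall n, conv (conv b b) e n = ps1 n) ->
  (Cmod s * K <= 1 / 8)%R ->
  let f := power_sum in
  hbar * (f (theta a) s - f a s) =
    2 * s ^ 2 * f c s - f a s ^ 2 - alpha * s ^ 2 - s ^ 3 /\
  hbar * (f (theta b) s - 2 * f b s) = -2 * (f a s * f b s) /\
  hbar * f (theta c) s = 2 * (f a s * f c s) + 2 * (f d s * f b s) /\
  hbar * (f (theta d) s + f d s) =
    2 * (f a s * f d s) + 1 - t2 * (s ^ 4 * f e s) /\
  f b s ^ 2 * f e s = 1.
Proof.
intros HK Ha Hb Hc Hd He Hq Hbe Hs f.
assert (P : forall g, geometric M K g -> is_power_sum g s (f g s)).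
{ intros g Hg; apply power_sum_correct with M K; [lra|easy|lra]. }
assert (PT : forall g, geometric M K g -> is_power_sum (theta g) s (f (theta g) s)).
{ intros g Hg; apply power_sum_correct with M (2 * K)%R; [lra| |lra].
  apply geometric_theta; [lra|easy]. }
assert (B : forall g, geometric M K g ->
  forall k, (Cmod (s ^ k * g k) <= M * (1 / 4) ^ k)%R).
{ intros g Hg; apply geometric_term with K; [lra|easy|lra]. }
assert (PC : forall g h, geometric M K g -> geometric M K h ->
  is_power_sum (conv g h) s (f g s * f h s)).
{ intros g h Hg Hh; apply power_sum_conv with M M; auto. }
assert (PX : forall g, geometric M K g ->
  is_power_sum (mulX (mulX (mulX (mulX g)))) s (s * (s * (s * (s * f g s)))))
  by (intros g Hg; repeat apply power_sum_mulX; auto).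
assert (P1 := power_sum_ps1 s).
assert (PX2 : is_power_sum (mulX (mulX ps1)) s (s * (s * 1)))
  by (repeat apply power_sum_mulX; exact P1).
assert (PX3 := power_sum_mulX _ _ _ PX2).
assert (PXc : is_power_sum (mulX (mulX c)) s (s * (s * f c s)))
  by (repeat apply power_sum_mulX; auto).
assert (L := power_sum_lin).
split; [|split; [|split; [|split]]].
- assert (E1 := L hbar (- hbar) _ _ _ _ _ (PT a Ha) (P a Ha)).
  assert (E2 := L 1 1 _ _ _ _ _ (L 2 (-1) _ _ _ _ _ PXc (PC a a Ha Ha))
    (L (- alpha) (-1) _ _ _ _ _ PX2 PX3)).
  refine (eq_trans _ (eq_trans (power_sum_unique _ _ _ _
    (power_sum_ext _ _ _ _ _ E1) E2) _)); [ring| |ring].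
  intros n; unfold theta; destruct (Hq n) as [E _].
  transitivity (hbar * (RtoC (INR n) - 1) * a n); [ring|rewrite E; ring].
- assert (E1 := L hbar (- 2 * hbar) _ _ _ _ _ (PT b Hb) (P b Hb)).
  (* A zero multiple of [ps1] fills the second slot of [power_sum_lin]. *)
  assert (E2 := L (-2) 0 _ _ _ _ _ (PC a b Ha Hb) P1).
  refine (eq_trans _ (eq_trans (power_sum_unique _ _ _ _
    (power_sum_ext _ _ _ _ _ E1) E2) _)); [ring| |ring].
  intros n; unfold theta; destruct (Hq n) as [_ [E _]].
  transitivity (hbar * (RtoC (INR n) - 2) * b n); [ring|rewrite E; ring].
- assert (E1 := L hbar 0 _ _ _ _ _ (PT c Hc) P1).
  assert (E2 := L 2 2 _ _ _ _ _ (PC a c Ha Hc) (PC d b Hd Hb)).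
  refine (eq_trans _ (eq_trans (power_sum_unique _ _ _ _
    (power_sum_ext _ _ _ _ _ E1) E2) _)); [ring| |ring].
  intros n; unfold theta; destruct (Hq n) as [_ [_ [E _]]].
  rewrite <- E; ring.
- assert (E1 := L hbar hbar _ _ _ _ _ (PT d Hd) (P d Hd)).
  assert (E2 := L 1 1 _ _ _ _ _ (L 2 1 _ _ _ _ _ (PC a d Ha Hd) P1)
    (L (- t2) 0 _ _ _ _ _ (PX e He) P1)).
  refine (eq_trans _ (eq_trans (power_sum_unique _ _ _ _
    (power_sum_ext _ _ _ _ _ E1) E2) _)); [ring| |ring].
  intros n; unfold theta; destruct (Hq n) as [_ [_ [_ [E _]]]].
  transitivity (hbar * (RtoC (INR n) + 1) * d n); [ring|rewrite E; ring].
- apply (power_sum_unique ps1 s); [|exact P1].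
  apply (power_sum_ext _ _ _ _ Hbe).
  replace (f b s ^ 2) with (f b s * f b s) by ring.
  apply power_sum_conv with (M * M)%R M; auto.
  (* The product [b * b] is geometric only with ratio 2K, yet must be multiplied once more at rate
     1/4; this accounts for the bound 1/8 on [Cmod s * K]. *)
  apply geometric_term with (2 * K)%R; [lra| |lra].
  intros n; apply Rle_trans with (1 := Cmod_conv_le b b M M K n
    (fun k _ => Hb k) (fun k _ => Hb k)).
  rewrite Rpow_mult_distr.
  replace (M * M * (2 ^ n * K ^ n))%R with (2 ^ n * (M * M * K ^ n))%R by ring.
  apply Rmult_le_compat_r; [|apply INR_lt_pow2].
  apply Rmult_le_pos; [apply Rle_0_sqr|apply pow_le; lra].
Qed.

Definition laurent_sum (u : laurent) (alpha t : C) : C :=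
  Cpowz (t - alpha) (lord u) * power_sum (lcoef u) (t - alpha).

Lemma is_laurent_sum_geometric (u : laurent) (M K : R) (alpha t : C) :
  (0 < K)%R -> geometric M K (lcoef u) -> punctured_disc alpha (/ (8 * K)) t ->
  is_laurent_sum u alpha t (laurent_sum u alpha t).
Proof.
intros HK Hu [_ Ht]; exists (power_sum (lcoef u) (t - alpha)); split; [|easy].
apply power_sum_correct with M K; [lra|easy|].
apply Rle_trans with (/ (8 * K) * K)%R; [apply Rmult_le_compat_r; lra|].
replace (/ (8 * K) * K)%R with (1 / 8)%R by (field; lra); lra.
Qed.

Lemma converges_near_geometric (u : laurent) (M K : R) (alpha : C) :
  (0 < K)%R -> geometric M K (lcoef u) -> converges_near u alpha.
Proof.
intros HK Hu; exists (/ (8 * K))%R; split; [apply Rinv_0_lt_compat; lra|].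
intros t Ht; eexists; now apply is_laurent_sum_geometric with M K.
Qed.

Lemma garnier_solution_laurent_sum (hbar t2 alpha : C) (a b c d e : nat -> C)
    (M K : R) (t : C) :
  hbar <> 0 ->
  (0 < K)%R -> geometric M K a -> geometric M K b -> geometric M K c ->
  geometric M K d -> geometric M K e ->
  quadratic_system hbar t2 alpha a b c d e ->
  (forall n, conv (conv b b) e n = ps1 n) ->
  punctured_disc alpha (/ (8 * K)) t ->
  garnier_solution_at hbar t2 (laurent_sum (Laurent (-1) a) alpha)
    (laurent_sum (Laurent (-2) b) alpha) (laurent_sum (Laurent 0 c) alpha)
    (laurent_sum (Laurent 1 d) alpha) t.
Proof.
intros Hh HK Ha Hb Hc Hd He Hq Hbe [Ht0 Ht].
apply Cmod_gt_0 in Ht0.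
assert (Hs : (Cmod (t - alpha) * K <= 1 / 8)%R).
{ apply Rle_trans with (/ (8 * K) * K)%R; [apply Rmult_le_compat_r; lra|].
  right; field; lra. }
destruct (power_sum_equations _ _ _ _ _ _ _ _ _ _ _ HK Ha Hb Hc Hd He Hq Hbe Hs)
  as [Ea [Eb [Ec [Ed Ee]]]].
assert (DP : forall g, geometric M K g -> is_Cderive
  (fun x => power_sum g (x - alpha)) t
  (power_sum (theta g) (t - alpha) / (t - alpha))).
{ intros g Hg; apply is_Cderive_shift; now apply is_Cderive_power_sum with M K. }
assert (DI : is_Cderive (fun x => / (x - alpha)) t (- / (t - alpha) ^ 2))
  by (apply (is_Cderive_shift (fun x => / x)); now apply is_Cderive_inv).
assert (DX : is_Cderive (fun x => x - alpha) t 1)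
  by (apply (is_Cderive_shift (fun x => x)), is_Cderive_id).
(* The identity [fb^2 fe = 1] excludes zeros of [q2] on the whole punctured disc. *)
assert (Hq2 : laurent_sum (Laurent (-2) b) alpha t <> 0).
{ unfold laurent_sum; apply Cmult_neq_0.
  - now apply Cinv_neq_0, Cpow_nz.
  - simpl; intros H; rewrite H in Ee; apply C1_nz; rewrite <- Ee; ring. }
split; [exact Hq2|].
assert (X1 : forall x, laurent_sum (Laurent (-1) a) alpha x =
  / (x - alpha) * power_sum a (x - alpha)).
{ intros x; unfold laurent_sum; simpl.
  change (Pos.to_nat 1) with 1%nat; simpl; now rewrite Cmult_1_r. }
assert (X2 : forall x, laurent_sum (Laurent (-2) b) alpha x =
  / ((x - alpha) * (x - alpha)) * power_sum b (x - alpha)).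
{ intros x; unfold laurent_sum; simpl.
  change (Pos.to_nat 2) with 2%nat; simpl; now rewrite Cmult_1_r. }
assert (X3 : forall x, laurent_sum (Laurent 0 c) alpha x = power_sum c (x - alpha))
  by (intros x; unfold laurent_sum; simpl; apply Cmult_1_l).
assert (X4 : forall x, laurent_sum (Laurent 1 d) alpha x =
  (x - alpha) * power_sum d (x - alpha)).
{ intros x; unfold laurent_sum; simpl.
  change (Pos.to_nat 1) with 1%nat; simpl; now rewrite Cmult_1_r. }
set (s := t - alpha) in *.
set (fa := power_sum a s) in *; set (fb := power_sum b s) in *;
set (fc := power_sum c s) in *; set (fd := power_sum d s) in *;
set (fe := power_sum e s) in *.
set (ta := power_sum (theta a) s) in *; set (tb := power_sum (theta b) s) in *;
set (tc := power_sum (theta c) s) in *; set (td := power_sum (theta d) s) in *.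
(* Product rule for A/s, B/s^2, C and sD, each derivative of a power series being its [theta]
   divided by s. *)
exists ((ta - fa) / s ^ 2), ((tb - 2 * fb) / s ^ 3), (tc / s), (td + fd).
split.
- split; [|split; [|split]].
  + eapply is_Cderive_eq; [intros x; symmetry; apply X1|
      |apply is_Cderive_mult; [apply DI|apply (DP a Ha)]].
    cbv beta; fold s fa ta; field; exact Ht0.
  + eapply is_Cderive_eq; [intros x; symmetry; apply X2|
      |apply is_Cderive_mult; [|apply (DP b Hb)]].
    2: apply (is_Cderive_comp (fun x => / x) (fun x => (x - alpha) * (x - alpha)));
      [apply is_Cderive_inv; fold s; now apply Cmult_neq_0
      |apply is_Cderive_mult; exact DX].
    cbv beta; fold s fb tb; field; exact Ht0.
  + eapply is_Cderive_eq; [intros x; symmetry; apply X3| |apply (DP c Hc)].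
    reflexivity.
  + eapply is_Cderive_eq; [intros x; symmetry; apply X4|
      |apply is_Cderive_mult; [exact DX|apply (DP d Hd)]].
    cbv beta; fold s fd td; field; exact Ht0.
- destruct (H1_partial_derivatives t2 t
    (laurent_sum (Laurent (-1) a) alpha t) (laurent_sum (Laurent (-2) b) alpha t)
    (laurent_sum (Laurent 0 c) alpha t) (laurent_sum (Laurent 1 d) alpha t) Hq2)
    as [D1 [D2 [D3 D4]]].
  assert (Hb0 : fb <> 0)
    by (intros H; rewrite H in Ee; apply C1_nz; rewrite <- Ee; ring).
  (* Turns the auxiliary term [t2 s^4 fe] back into [t2 / q2^2]. *)
  assert (Hfe : fe = 1 / fb ^ 2) by (rewrite <- Ee; now field).
  split; [|split; [|split]].
  + eapply is_Cderive_eq; [reflexivity| |exact D1].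
    rewrite X1, X3; fold s fa fc.
    transitivity (hbar * (ta - fa) / s ^ 2); [|now field].
    rewrite Ea; unfold s; field; exact Ht0.
  + eapply is_Cderive_eq; [reflexivity| |exact D2].
    rewrite X1, X2; fold s fa fb.
    transitivity (hbar * (tb - 2 * fb) / s ^ 3); [|now field].
    rewrite Eb; field; exact Ht0.
  + eapply is_Cderive_eq; [reflexivity| |exact D3].
    rewrite X1, X2, X3, X4; fold s fa fb fc fd.
    transitivity (- (hbar * tc) / s); [|now field].
    rewrite Ec; field; exact Ht0.
  + eapply is_Cderive_eq; [reflexivity| |exact D4].
    rewrite X1, X2, X4; fold s fa fb fd.
    rewrite Ed, Hfe; field; now split.
Qed.

(** * Uniqueness of the formal solution *)

(** Linearization at order n: for two solutions that agree below n, only the end terms differ. *)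
Lemma conv_sub (f f' g g' : nat -> C) (n : nat) : (1 <= n)%nat ->
  (forall k, (k < n)%nat -> f k = f' k) ->
  (forall k, (k < n)%nat -> g k = g' k) ->
  conv f g n - conv f' g' n = f O * (g n - g' n) + (f n - f' n) * g O.
Proof.
intros Hn Hf Hg; destruct n as [|[|n]]; [lia| |].
- rewrite !conv_1, (Hf O), (Hg O) by lia; ring.
- rewrite !conv_SS, (conv_divX_ext f f' g g') by (auto with arith).
  rewrite (Hf O), (Hg O) by lia; ring.
Qed.

Lemma Cmult_eq_cancel (x y z : C) : x <> 0 -> x * (y - z) = 0 -> y = z.
Proof.
intros Hx H; apply Ceq_minus.
destruct (Ceq_dec (y - z) 0) as [E|E]; [exact E|].
now contradict H; apply Cmult_neq_0.
Qed.

Section Uniqueness.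

Context (hbar t2 alpha : C) (a b c d a' b' c' d' : nat -> C).
Context (Hh : hbar <> 0).
Context (sol : garnier_equations hbar t2 alpha a b c d).
Context (sol' : garnier_equations hbar t2 alpha a' b' c' d').
Context (a0 : a O <> 0) (a0' : a' O <> 0) (b0 : b O <> 0).
Context (eq_b0 : b O = b' O) (eq_a3 : a 3%nat = a' 3%nat)
  (eq_a4 : a 4%nat = a' 4%nat).

(** At order 0 the equation of q1 reads [- hbar * x 0 = - x 0 ^ 2], so a genuine pole has residue
    [hbar]. *)
Lemma a0_hbar (x y z w : nat -> C) :
  garnier_equations hbar t2 alpha x y z w -> x O <> 0 -> x O = hbar.
Proof.
intros [E _] H; specialize (E O); rewrite conv_0 in E; simpl in E.
symmetry; apply Cmult_eq_cancel with (x O); [exact H|].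
transitivity (- (hbar * (0 - 1) * x O) - x O * x O); [ring|rewrite E; ring].
Qed.

(** At order 0 the last equation is [y 0 ^ 2 * (hbar * w 0 - 2 * hbar * w 0 - 1) = 0]. *)
Lemma d0_hbar (x y z w : nat -> C) :
  garnier_equations hbar t2 alpha x y z w -> x O <> 0 -> y O <> 0 ->
  w O = - / hbar.
Proof.
intros HS Hx Hy; assert (H := a0_hbar x y z w HS Hx).
destruct HS as [_ [_ [_ E]]]; specialize (E O).
rewrite !conv_0, H in E; simpl in E.
apply Cmult_eq_cancel with (y O * y O * hbar); [now repeat apply Cmult_neq_0|].
transitivity (- (y O * y O * (hbar * (0 + 1) * w O - (2 * (hbar * w O) + 1))));
  [field; exact Hh|rewrite E; ring].
Qed.

Lemma unique_a (n : nat) : (1 <= n)%nat ->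
  (forall k, (k < n)%nat -> a k = a' k) ->
  (forall k, (k + 2 <= n)%nat -> c k = c' k) -> a n = a' n.
Proof.
intros Hn Ha Hc; destruct sol as [E _], sol' as [E' _].
specialize (E n); specialize (E' n).
assert (Hm : mulX (mulX c) n = mulX (mulX c') n)
  by (destruct n as [|[|n]]; [easy..|apply Hc; lia]).
assert (F := conv_sub a a' a a' n Hn Ha Ha).
rewrite (a0_hbar a b c d) in F by easy.
rewrite Hm in E.
apply Cmult_eq_cancel with (hbar * (RtoC (INR n) + 1)).
{ apply Cmult_neq_0; [easy|apply INR_plus_neq_0; lra]. }
transitivity (hbar * (RtoC (INR n) - 1) * a n - hbar * (RtoC (INR n) - 1) * a' n
  + (hbar * (a n - a' n) + (a n - a' n) * hbar)); [ring|].
rewrite <- F, E, E'; ring.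
Qed.

(** Reads the equation of [a] backwards; this is how [a 3] and [a 4] fix [c 1] and [c 2] around the
    resonances. *)
Lemma unique_c (n : nat) :
  (forall k, (k <= n + 2)%nat -> a k = a' k) -> c n = c' n.
Proof.
intros Ha; destruct sol as [E _], sol' as [E' _].
specialize (E (n + 2)%nat); specialize (E' (n + 2)%nat).
rewrite <- (conv_ext a a' a a'), <- (Ha (n + 2)%nat) in E' by auto.
rewrite E in E'; clear E.
replace (n + 2)%nat with (S (S n)) in E' by lia.
simpl mulX in E'.
apply Cmult_eq_cancel with (RtoC 2); [intros H; apply RtoC_inj in H; lra|].
apply Ceq_minus in E'; rewrite <- E'; ring.
Qed.

(** The conclusions on [d] and [c] keep their factors n - 1 and n - 2, so that the lemma also
    applies at the resonant orders. *)
Lemma unique_step (n : nat) : (1 <= n)%nat ->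
  (forall k, (k < n)%nat ->
     a k = a' k /\ b k = b' k /\ c k = c' k /\ d k = d' k) ->
  a n = a' n ->
  b n = b' n /\ hbar * (RtoC (INR n) - 1) * (d n - d' n) = 0 /\
  hbar * (RtoC (INR n) - 2) * (c n - c' n) = 2 * b O * (d n - d' n).
Proof.
intros Hn H Han.
assert (Ha : forall k, (k < n)%nat -> a k = a' k) by (intros; now apply H).
assert (Hb : forall k, (k < n)%nat -> b k = b' k) by (intros; now apply H).
assert (Hc : forall k, (k < n)%nat -> c k = c' k) by (intros; now apply H).
assert (Hd : forall k, (k < n)%nat -> d k = d' k) by (intros; now apply H).
assert (A0 := a0_hbar a b c d sol a0).
assert (Hbn : b n = b' n).
{ destruct sol as [_ [E _]], sol' as [_ [E' _]].
  specialize (E n); specialize (E' n).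
  assert (F := conv_sub a a' b b' n Hn Ha Hb); rewrite A0, Han in F.
  apply Cmult_eq_cancel with (hbar * RtoC (INR n)).
  { apply Cmult_neq_0; [easy|intros H0; apply RtoC_inj in H0; revert H0].
    apply not_0_INR; lia. }
  transitivity (hbar * (RtoC (INR n) - 2) * b n
    - hbar * (RtoC (INR n) - 2) * b' n
    + 2 * (hbar * (b n - b' n) + (a' n - a' n) * b O)); [ring|].
  rewrite <- F, E, E'; ring. }
split; [exact Hbn|split].
- destruct sol as [_ [_ [_ E]]], sol' as [_ [_ [_ E']]].
  specialize (E n); specialize (E' n); rewrite <- E' in E; clear E'.
  set (X := fun k => hbar * (RtoC (INR k) + 1) * d k - (2 * conv a d k + ps1 k))
    in E.
  set (X' := fun k => hbar * (RtoC (INR k) + 1) * d' k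
                      - (2 * conv a' d' k + ps1 k)) in E.
  assert (Hbb : forall k, (k <= n)%nat -> conv b b k = conv b' b' k).
  { intros k Hk; apply conv_ext; intros i Hi;
      (destruct (Nat.eq_dec i n) as [->|Hin]; [exact Hbn|apply Hb; lia]). }
  assert (F := conv_sub (conv b b) (conv b' b') X X' n Hn
    (fun k Hk => Hbb k (Nat.lt_le_incl _ _ Hk))).
  rewrite E, (Hbb n (le_n n)), conv_0 in F.
  (* As [X] and [X'] agree below n, comparing the convolutions at order n leaves
     [b 0 ^ 2 * (X n - X' n)]: the factor [q2^2] cancels. *)
  assert (HX : X n = X' n).
  { apply Cmult_eq_cancel with (b O * b O); [now apply Cmult_neq_0|].
    transitivity (conv (conv b' b') X' n - conv (conv b' b') X' n); [|ring].
    rewrite F; [ring|].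
    intros k Hk; unfold X, X'.
    rewrite (conv_ext a a' d d'), (Hd k) by (auto || intros; apply H; lia).
    reflexivity. }
  assert (G := conv_sub a a' d d' n Hn Ha Hd); rewrite A0, Han in G.
  transitivity (X n - X' n); [|rewrite HX; ring].
  transitivity (hbar * (RtoC (INR n) + 1) * (d n - d' n)
    - 2 * (hbar * (d n - d' n) + (a' n - a' n) * d O)); [ring|].
  rewrite <- G; unfold X, X'; ring.
- destruct sol as [_ [_ [E _]]], sol' as [_ [_ [E' _]]].
  specialize (E n); specialize (E' n).
  assert (F := conv_sub a a' c c' n Hn Ha Hc); rewrite A0, Han in F.
  assert (G := conv_sub d d' b b' n Hn Hd Hb); rewrite Hbn in G.
  transitivity (hbar * RtoC (INR n) * c n - hbar * RtoC (INR n) * c' n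
    - 2 * (hbar * (c n - c' n) + (a' n - a' n) * c O)); [ring|].
  rewrite <- F, E, E'.
  transitivity (2 * (conv d b n - conv d' b' n)); [ring|rewrite G; ring].
Qed.

Lemma garnier_equations_unique (n : nat) :
  a n = a' n /\ b n = b' n /\ c n = c' n /\ d n = d' n.
Proof.
assert (Ea0 : a O = a' O).
{ rewrite (a0_hbar a b c d), (a0_hbar a' b' c' d'); auto. }
assert (Ed0 : d O = d' O).
{ rewrite (d0_hbar a b c d), (d0_hbar a' b' c' d'); auto.
  now rewrite <- eq_b0. }
assert (Ea1 : a 1%nat = a' 1%nat).
{ apply unique_a; [lia| |lia].
  intros k Hk; replace k with O by lia; exact Ea0. }
assert (H0 : a O = a' O /\ b O = b' O /\ c O = c' O /\ d O = d' O).
{ repeat split; auto.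
  destruct sol as [_ [_ [E _]]], sol' as [_ [_ [E' _]]].
  specialize (E O); specialize (E' O); rewrite !conv_0 in E, E'; simpl in E, E'.
  apply Cmult_eq_cancel with (2 * a O).
  { apply Cmult_neq_0; [intros H; apply RtoC_inj in H; lra|easy]. }
  rewrite <- Ea0, <- eq_b0, <- Ed0 in E'.
  transitivity (2 * (a O * c O) + 2 * (d O * b O)
    - (2 * (a O * c' O) + 2 * (d O * b O))); [ring|].
  rewrite <- E, <- E'; ring. }
assert (Ea2 : a 2%nat = a' 2%nat).
{ apply unique_a; [lia|intros [|[|k]] Hk; [easy..|lia]|].
  intros k Hk; replace k with O by lia; apply H0. }
assert (Hlt1 : forall k, (k < 1)%nat ->
  a k = a' k /\ b k = b' k /\ c k = c' k /\ d k = d' k)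
  by (intros [|k] Hk; [exact H0|lia]).
assert (Ha : forall k, (k <= 4)%nat -> a k = a' k)
  by (intros [|[|[|[|[|k]]]]] Hk; [easy..|lia]).
assert (H1 : a 1%nat = a' 1%nat /\ b 1%nat = b' 1%nat /\ c 1%nat = c' 1%nat /\
  d 1%nat = d' 1%nat).
(* Resonance of [d]: [c 1] is known from [a 3], and the equation of [c] is solved for [d 1]
   instead. *)
{ destruct (unique_step 1 ltac:(lia) Hlt1 Ea1) as [Eb [_ Ed]].
  assert (Ec : c 1%nat = c' 1%nat) by (apply unique_c; intros; apply Ha; lia).
  repeat split; auto.
  apply Cmult_eq_cancel with (2 * b O).
  { apply Cmult_neq_0; [intros H; apply RtoC_inj in H; lra|easy]. }
  rewrite <- Ed, Ec; ring. }
assert (Hlt2 : forall k, (k < 2)%nat ->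
  a k = a' k /\ b k = b' k /\ c k = c' k /\ d k = d' k)
  by (intros [|[|k]] Hk; [exact H0|exact H1|lia]).
assert (H2 : a 2%nat = a' 2%nat /\ b 2%nat = b' 2%nat /\ c 2%nat = c' 2%nat /\
  d 2%nat = d' 2%nat).
(* Resonance of [c]: [c 2] is known from [a 4], and [d 2] follows as usual. *)
{ destruct (unique_step 2 ltac:(lia) Hlt2 Ea2) as [Eb [Ed _]].
  assert (Ec : c 2%nat = c' 2%nat) by (apply unique_c; intros; apply Ha; lia).
  repeat split; auto.
  apply Cmult_eq_cancel with (hbar * (RtoC (INR 2) - 1)); [|exact Ed].
  apply Cmult_neq_0; [easy|].
  rewrite <- RtoC_minus; intros H; apply RtoC_inj in H; simpl in H; lra. }
induction n as [n IH] using lt_wf_ind.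
destruct (le_lt_dec n 2) as [Hn|Hn].
{ destruct n as [|[|[|n]]]; [easy..|lia]. }
assert (Ea : a n = a' n) by (apply unique_a; [lia|intros k Hk; apply IH; lia..]).
destruct (unique_step n ltac:(lia) IH Ea) as [Eb [Ed Ec]].
assert (Hn3 : (3 <= INR n)%R) by (apply (le_INR 3) in Hn; simpl in Hn; lra).
apply Cmult_eq_cancel in Ed.
2: { apply Cmult_neq_0; [easy|].
  rewrite <- RtoC_minus; intros H; apply RtoC_inj in H; lra. }
repeat split; auto.
apply Cmult_eq_cancel with (hbar * (RtoC (INR n) - 2)).
{ apply Cmult_neq_0; [easy|].
  rewrite <- RtoC_minus; intros H; apply RtoC_inj in H; lra. }
rewrite Ec, Ed; ring.
Qed.

End Uniqueness.

(** * Explicit low-order coefficients and the conclusion *)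

Lemma Cdiv_unique (x y z : C) : x <> 0 -> x * y = z -> y = z / x.
Proof. intros Hx <-; now field. Qed.

Lemma low_order_coefficients (hbar t2 alpha beta gamma delta : C)
    (a b c d e : nat -> C) :
  hbar <> 0 -> beta <> 0 ->
  initial hbar alpha beta gamma delta a b c d e ->
  recursion hbar t2 a b c d e ->
  (a 3%nat = gamma / hbar ^ 2 /\
   b 3%nat = - ((2 * beta * gamma) / (3 * hbar)) /\
   c 3%nat = - ((4 * alpha * gamma - 12 * beta * gamma + alpha * hbar
                 - 2 * beta * hbar) / (3 * hbar ^ 3)) /\
   d 3%nat = (4 * alpha * gamma - 20 * beta * gamma + alpha * hbar
              - 2 * beta * hbar) / (12 * beta * hbar ^ 4)) /\
  (a 4%nat = delta / hbar ^ 3 /\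
   b 4%nat = (alpha ^ 2 * beta - 4 * alpha * beta ^ 2 + 4 * beta ^ 3
              - 9 * beta * delta) / (18 * hbar ^ 2)) /\
  a 5%nat = - ((3 * alpha * gamma - 10 * beta * gamma + alpha * hbar
                - 2 * beta * hbar) / (9 * hbar ^ 4)) /\
  b 5%nat = 2 * (- (2 * alpha * beta * gamma) + alpha * beta * hbar
                 - 2 * beta ^ 2 * hbar) / (45 * hbar ^ 3).
Proof.
intros Hh Hb [[a0 [b0 [c0 [d0 e0]]]] [[a1 [b1 [c1 [d1 e1]]]]
  [a2 [b2 [c2 [d2 e2]]]]]] Hr.
assert (NZ : forall (m : nat) (x : R), (0 < x)%R ->
  hbar * (RtoC (INR m) + RtoC x) <> 0)
  by (intros m x Hx; apply Cmult_neq_0; [easy|now apply INR_plus_neq_0]).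
destruct (Hr 0%nat) as [A3 [B3 [C3 [D3 _]]]].
destruct (Hr 1%nat) as [A4 [B4 _]].
destruct (Hr 2%nat) as [A5 [B5 _]].
apply Cdiv_unique in A3, B3, C3, D3, A4, B4, A5, B5; try (apply NZ; lra).
rewrite !RtoC_INR_S in *; cbn [Nat.add INR ps1 mulX] in *.
rewrite conv_1 in A3, B3, D3; rewrite !conv_1 in C3; rewrite conv_2 in A4, B4.
rewrite conv_S_l, conv_2 in A5, B5; unfold divX in *.
assert (R3 : a 3%nat = gamma / hbar ^ 2).
{ rewrite A3, c1, a1, a2; field; exact Hh. }
assert (S3 : b 3%nat = - ((2 * beta * gamma) / (3 * hbar))).
{ rewrite B3, R3, b0, a1, a2, b1, b2; field; exact Hh. }
assert (V3 : d 3%nat = (4 * alpha * gamma - 20 * beta * gamma + alpha * hbar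
              - 2 * beta * hbar) / (12 * beta * hbar ^ 4)).
{ rewrite D3, R3, d0, a1, a2, d1, d2; field; now split. }
assert (T3 : c 3%nat = - ((4 * alpha * gamma - 12 * beta * gamma + alpha * hbar
                 - 2 * beta * hbar) / (3 * hbar ^ 3))).
{ rewrite C3, R3, S3, V3, b0, c0, d0, a1, a2, b1, b2, c1, c2, d1, d2.
  field; now split. }
assert (R4 : a 4%nat = delta / hbar ^ 3).
{ rewrite A4, R3, c2, a1, a2; field; exact Hh. }
assert (S4 : b 4%nat = (alpha ^ 2 * beta - 4 * alpha * beta ^ 2 + 4 * beta ^ 3
              - 9 * beta * delta) / (18 * hbar ^ 2)).
{ rewrite B4, R4, R3, S3, b0, a1, a2, b1, b2; field; exact Hh. }
assert (R5 : a 5%nat = - ((3 * alpha * gamma - 10 * beta * gamma + alpha * hbar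
                - 2 * beta * hbar) / (9 * hbar ^ 4))).
{ rewrite A5, R4, R3, T3, a1, a2; field; exact Hh. }
repeat split; auto.
rewrite B5, R5, R4, R3, S4, S3, b0, a1, a2, b1, b2; field; exact Hh.
Qed.

Definition laurent_family (a b c d : nat -> C) (i : unknown) : laurent :=
  match i with
  | Q1 => Laurent (-1) a | Q2 => Laurent (-2) b
  | P1 => Laurent 0 c | P2 => Laurent 1 d
  end.

Theorem proposition3p8 :
  forall hbar t2 : C, hbar <> 0 -> t2 <> 0 ->
  (forall alpha beta gamma delta : C, beta <> 0 ->
     exists u : unknown -> laurent,
       expands_as (u Q1) (-1)
         [ hbar;
           RtoC 0;
           - ((alpha - 2 * beta) / (3 * hbar));
           gamma / hbar ^ 2;
           delta / hbar ^ 3;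
           - ((3 * alpha * gamma - 10 * beta * gamma + alpha * hbar
               - 2 * beta * hbar) / (9 * hbar ^ 4)) ] /\
       expands_as (u Q2) (-2)
         [ beta * hbar ^ 2;
           RtoC 0;
           1 / 3 * (alpha * beta - 2 * beta ^ 2);
           - ((2 * beta * gamma) / (3 * hbar));
           (alpha ^ 2 * beta - 4 * alpha * beta ^ 2 + 4 * beta ^ 3
            - 9 * beta * delta) / (18 * hbar ^ 2);
           2 * (- (2 * alpha * beta * gamma) + alpha * beta * hbar
                - 2 * beta ^ 2 * hbar) / (45 * hbar ^ 3) ] /\
       expands_as (u P1) 0
         [ beta;
           1 / 2 + 2 * gamma / hbar;
           (alpha ^ 2 - 4 * alpha * beta + 4 * beta ^ 2 + 45 * delta)
             / (18 * hbar ^ 2);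
           - ((4 * alpha * gamma - 12 * beta * gamma + alpha * hbar
               - 2 * beta * hbar) / (3 * hbar ^ 3)) ] /\
       expands_as (u P2) 1
         [ - (1 / hbar);
           - ((4 * gamma + hbar) / (4 * beta * hbar ^ 2));
           2 * (alpha - 2 * beta) / (3 * hbar ^ 3);
           (4 * alpha * gamma - 20 * beta * gamma + alpha * hbar
            - 2 * beta * hbar) / (12 * beta * hbar ^ 4) ] /\
       exists (r : R) (q1 q2 p1 p2 : C -> C),
         (0 < r)%R /\
         forall t : C, punctured_disc alpha r t ->
           is_laurent_sum (u Q1) alpha t (q1 t) /\
           is_laurent_sum (u Q2) alpha t (q2 t) /\
           is_laurent_sum (u P1) alpha t (p1 t) /\
           is_laurent_sum (u P2) alpha t (p2 t) /\
           garnier_solution_at hbar t2 q1 q2 p1 p2 t) /\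
  passes_painleve_test unknown 4 (garnier_formal_solution hbar t2)
    garnier_exponent garnier_free.
Proof.
intros hbar t2 Hh Ht2.
(* One construction serves both halves of the theorem; in the second half its parameters are
   recovered from the prescribed coefficients. *)
assert (Series : forall alpha beta gamma delta : C, beta <> 0 ->
  exists (a b c d e : nat -> C) (M K : R),
    initial hbar alpha beta gamma delta a b c d e /\
    recursion hbar t2 a b c d e /\
    quadratic_system hbar t2 alpha a b c d e /\
    (forall n, conv (conv b b) e n = ps1 n) /\
    (0 < K)%R /\ geometric M K a /\ geometric M K b /\ geometric M K c /\
    geometric M K d /\ geometric M K e).
{ intros alpha beta gamma delta Hb.
  destruct (coefficients_exist hbar t2 alpha beta gamma delta Hh)
    as [a [b [c [d [e [Hi Hr]]]]]].
  destruct (recursion_geometric hbar t2 a b c d e Hh Hr)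
    as [M [K [_ [HK [Ga [Gb [Gc [Gd Ge]]]]]]]].
  assert (Hq := quadratic_equations _ _ _ _ _ _ _ _ _ _ _ Hh Hb Hi Hr).
  exists a, b, c, d, e, M, K; repeat (split; [easy|]); split.
  { apply (inverse_square hbar a); [easy| |intros n; apply Hq..].
    destruct Hi as [[_ [-> [_ [_ ->]]]] _]; field; now split. }
  repeat split; auto; lra. }
split.
- intros alpha beta gamma delta Hb.
  destruct (Series alpha beta gamma delta Hb) as [a [b [c [d [e [M [K
    [Hi [Hr [Hq [Hbe [HK [Ga [Gb [Gc [Gd Ge]]]]]]]]]]]]]]]].
  destruct (low_order_coefficients _ _ _ _ _ _ _ _ _ _ _ Hh Hb Hi Hr)
    as [[a3 [b3 [c3 d3]]] [[a4 b4] [a5 b5]]].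
  destruct Hi as [[a0 [b0 [c0 [d0 _]]]] [[a1 [b1 [c1 [d1 _]]]]
    [a2 [b2 [c2 [d2 _]]]]]].
  exists (laurent_family a b c d).
  split; [|split; [|split; [|split]]].
  1-4: split; [reflexivity|];
    intros n Hn; simpl in Hn;
    do 6 (destruct n as [|n]; [easy || lia|]); lia.
  exists (/ (8 * K))%R, (laurent_sum (Laurent (-1) a) alpha),
    (laurent_sum (Laurent (-2) b) alpha), (laurent_sum (Laurent 0 c) alpha),
    (laurent_sum (Laurent 1 d) alpha).
  split; [apply Rinv_0_lt_compat; lra|intros t Ht].
  repeat (split; [now apply is_laurent_sum_geometric with M K|]).
  now apply garnier_solution_laurent_sum with e M K.
- split; [now exists Q1|split; [|split; [reflexivity|]]].
  { repeat constructor; simpl; intuition congruence. }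
  intros alpha value Hv expansion.
  (* Inverts [b 0 = beta hbar^2], [a 3 = gamma / hbar^2] and [a 4 = delta / hbar^3]. *)
  set (beta := value Q2 (-2)%Z / hbar ^ 2).
  set (gamma := value Q1 2%Z * hbar ^ 2).
  set (delta := value Q1 3%Z * hbar ^ 3).
  assert (Hb : beta <> 0).
  { apply Cmult_neq_0; [apply (Hv Q2); now left|].
    apply Cinv_neq_0; now apply Cpow_nz. }
  destruct (Series alpha beta gamma delta Hb) as [a [b [c [d [e [M [K
    [Hi [Hr [Hq [Hbe [HK [Ga [Gb [Gc [Gd Ge]]]]]]]]]]]]]]]].
  destruct (low_order_coefficients _ _ _ _ _ _ _ _ _ _ _ Hh Hb Hi Hr)
    as [[a3 _] [[a4 _] _]].
  destruct Hi as [[a0 [b0 [c0 [d0 _]]]] _].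
  assert (HG : garnier_equations hbar t2 alpha a b c d)
    by now apply garnier_equations_of_quadratic with e.
  assert (V2 : b O = value Q2 (-2)%Z) by (rewrite b0; unfold beta; now field).
  assert (V3 : a 3%nat = value Q1 2%Z) by (rewrite a3; unfold gamma; now field).
  assert (V4 : a 4%nat = value Q1 3%Z) by (rewrite a4; unfold delta; now field).
  assert (Hbn : b O <> 0) by (rewrite V2; apply (Hv Q2); now left).
  exists (laurent_family a b c d); split; [split; [|split]|split].
  + intros []; (split; [reflexivity|]); simpl.
    * now rewrite a0.
    * exact Hbn.
    * now rewrite c0.
    * rewrite d0; intros H; apply (Cinv_neq_0 hbar Hh).
      transitivity (- - (1 / hbar)); [now field|rewrite H; ring].
  + intros i k [E|[E|[E|[]]]]; injection E as <- <-; easy.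
  + now apply garnier_formal_solution_coef; [intros []|].
  + intros u' [Hl [Hf Hs]] i k.
    apply garnier_formal_solution_coef in Hs; [|intros j; apply Hl].
    (* The free coefficients are named by exponents of s; as q1 starts at -1, its exponents 2 and 3
       are the indices 3 and 4. *)
    assert (Hu : forall (j : unknown) (p : Z) (n : nat), In (j, p) garnier_free ->
      (p = garnier_exponent j + Z.of_nat n)%Z -> lcoef (u' j) n = value j p).
    { intros j p n Hin ->; rewrite <- (Hf j _ Hin), <- (proj1 (Hl j)).
      symmetry; apply coef_lord. }
    assert (Uniq := garnier_equations_unique hbar t2 alpha _ _ _ _ _ _ _ _ Hh
      HG Hs ltac:(now rewrite a0) (proj2 (Hl Q1)) Hbn
      ltac:(rewrite V2; symmetry; apply Hu; [now left|reflexivity])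
      ltac:(rewrite V3; symmetry; apply Hu; [now right; left|reflexivity])
      ltac:(rewrite V4; symmetry; apply Hu; [now right; right; left|reflexivity])).
    assert (E : forall n, lcoef (u' i) n = lcoef (laurent_family a b c d i) n)
      by (intros n; symmetry; destruct i; apply Uniq).
    unfold coef; rewrite E, (proj1 (Hl i)); now destruct i.
  + intros i; apply converges_near_geometric with M K; [lra|now destruct i].
Qed.
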